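(* Let $(\sigma_n)_{n=1}^\infty$ be an increasing sequence of positive integers with $\sigma_{n+1}-\sigma_n\ge n$ for all $n\ge1$ and such that the limit \[\beta:=\lim_{n\to\infty}\frac{\sigma_{n+1}-\sigma_n}{n}\] exists in $[1,\infty]$. Define \[G((\sigma_n)_{n=1}^\infty)=\{x\in J\colon a_{\sigma_n}(x),\ldots,a_{\sigma_n+n-1}(x)\ \text{is an arithmetic progression for all sufficiently large}\ n\}.\] Then \[\dim_{\rm H} G((\sigma_n)_{n=1}^\infty)=\begin{cases}\dfrac{\beta-1}{2\beta}&\text{if }\beta<\infty,\\ 1/2&\text{otherwise.}\end{cases}\]
   Context: Every irrational $x\in(0,1)$ has a regular continued fraction expansion $x=\cfrac{1}{a_1(x)+\cfrac{1}{a_2(x)+\cdots}}$ with partial quotients $a_n(x)\in\mathbb N$. $J=\{x\in(0,1)\setminus\mathbb Q\colon a_n(x)<a_{n+1}(x)\text{ for every }n\ge1\}$. $\dim_{\rm H}$ denotes Hausdorff dimension in $[0,1]$ with the Euclidean metric. *)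

(* Defs.v *)
From mathcomp Require Import all_boot all_order all_algebra.
From mathcomp Require Import all_classical all_reals all_analysis.
Set Implicit Arguments. Unset Strict Implicit. Unset Printing Implicit Defensive.
Import Order.TTheory GRing.Theory Num.Theory.
Local Open Scope classical_set_scope.
Local Open Scope ring_scope.

Section CF.
Variable R : realType.

Definition gauss (x : R) : R := x^-1 - (Num.floor (x^-1))%:~R.

(* n-th partial quotient (n >= 1): a_n(x) = floor (1 / T^(n-1) x) *)
Definition pq (n : nat) (x : R) : int := Num.floor ((iter n.-1 gauss x)^-1).

Definition irrational (x : R) : Prop := forall q : rat, x <> ratr q.

Definition Jset : set R :=
  [set x | 0 < x < 1 /\ irrational x /\ (forall n, (1 <= n)%N -> pq n x < pq n.+1 x)].

Definition is_AP (m n : nat) (x : R) : Prop :=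
  forall i, (i.+2 <= n)%N -> pq (m + i).+1 x - pq (m + i) x = pq m.+1 x - pq m x.

Definition Gset (sigma : nat -> nat) : set R :=
  [set x | Jset x /\ exists N, forall n, (N <= n)%N -> is_AP (sigma n) n x].

Local Open Scope ereal_scope.
Definition diam (U : set R) : \bar R :=
  ereal_sup [set (`|x - y|)%:E | x in U & y in U].

Definition hausdorff_content (s delta : R) (E : set R) : \bar R :=
  ereal_inf [set \sum_(0 <= i <oo) ((powR (fine (diam (U i))) s)%:E) |
             U in [set U : nat -> set R |
                   E `<=` \bigcup_i U i /\ forall i, diam (U i) <= delta%:E]].

Definition hausdorff_measure (s : R) (E : set R) : \bar R :=
  ereal_sup [set hausdorff_content s delta E | delta in [set d : R | (0 < d)%R]].

Definition hausdorff_dim (E : set R) : \bar R :=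
  ereal_inf [set s%:E | s in [set s : R | (0 < s)%R /\ hausdorff_measure s E = 0]].
End CF.

(* Main.v *)
(** Call a position free if it lies in no block [sigma_n, sigma_n + n). Near block n there are
about (beta - 1) n free positions for n positions filled by an arithmetic progression.

Upper bound. Points of G sharing their digits a_1, ..., a_m are at distance at most
prod a_i^(-2). Summing the s-th powers over the digits of one group, a free digit is smaller
than the first term A of the next progression and contributes sum_(b <= A) b^(-2s), which is of
order A^(1-2s) for s < 1/2, while the progression contributes about A^(-2sn). The total is about
A^(((1-2s)(beta-1) - 2s) n), whose sum over A (and over the difference) tends to 0 as soon as
s > (beta - 1) / (2 beta). For beta = +oo one only uses that the whole of J has dimension at
most 1/2.

Lower bound. Send t in [0, 1) to the point x_t whose digit at a free position i is
2^i + (the next i binary digits of t), and whose digits on block n are the multiples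
2^sigma_n, 2 * 2^sigma_n, ..., n * 2^sigma_n. If x_t and x_u first differ at digit j, then
|x_t - x_u| >= 2^(-j^2 - O(j)), while t and u share as many binary digits as the sum of the free
positions below j, which is (1 - 1/beta + o(1)) j^2 / 2. Hence |t - u| <= C |x_t - x_u|^s for
s < (beta - 1) / (2 beta), and the Lebesgue measure of [0, 1) bounds the Hausdorff measure of G
from below. *)

Require Import Defs.
From mathcomp Require Import all_boot all_order all_algebra.
From mathcomp Require Import all_classical all_reals all_analysis.
From mathcomp Require Import ring lra zify.
Import Order.TTheory GRing.Theory Num.Theory.
Set Implicit Arguments.
Unset Strict Implicit.
Unset Printing Implicit Defensive.
Local Open Scope classical_set_scope.
Local Open Scope ring_scope.

(** * Covers and Hausdorff measure *)

(** The cost bound is a real number, so that costs of covers can be added and scaled without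
    extended arithmetic. *)
Definition has_cover (R : realType) (s delta : R) (E : set R) (c : R) : Prop :=
  exists U : nat -> set R, [/\ E `<=` \bigcup_i U i,
    (forall i, diam (U i) <= delta%:E)%E &
    (\sum_(0 <= i <oo) ((powR (fine (diam (U i))) s)%:E) <= c%:E)%E].

Lemma diam_le (R : realType) (E : set R) (r : R) :
  (forall x y, E x -> E y -> `|x - y| <= r) -> (diam E <= r%:E)%E.
Proof.
move=> h; apply: ge_ereal_sup => _ [x Ex [y Ey <-]].
by rewrite lee_fin; exact: h.
Qed.

Lemma le_diam (R : realType) (E : set R) (r x y : R) :
  (diam E <= r%:E)%E -> E x -> E y -> `|x - y| <= fine (diam E).
Proof.
move=> Er Ex Ey.
have h : (`|x - y|%:E <= diam E)%E.
  by apply: ereal_sup_ubound; exists x => //; exists y.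
case: (diam E) h Er => //=.
Qed.

Lemma fine_diam_ge0 (R : realType) (E : set R) : 0 <= fine (diam E).
Proof.
have [->|/set0P[x Ex]] := eqVneq E set0.
  (* The empty set has diameter -oo, which [fine] sends to 0. *)
  rewrite /diam (_ : [set _ | _ in _ & _ in _] = set0) ?ereal_sup0 //.
  by apply/seteqP; split => // z [x []].
have h : (`|x - x|%:E <= diam E)%E.
  by apply: ereal_sup_ubound; exists x => //; exists x.
move: h; rewrite subrr normr0.
by case: (diam E) => //= r; rewrite lee_fin.
Qed.

Lemma fine_diam_le (R : realType) (E : set R) (r : R) :
  0 <= r -> (diam E <= r%:E)%E -> fine (diam E) <= r.
Proof. by move=> r0; case: (diam E) => //= z; rewrite lee_fin. Qed.

Lemma has_coverS (R : realType) (s d : R) (E F : set R) (c c' : R) :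
  E `<=` F -> c <= c' -> has_cover s d F c -> has_cover s d E c'.
Proof.
move=> EF cc' [U [FU dU sU]]; exists U; split => //.
- exact: (subset_trans EF).
- by apply: (le_trans sU); rewrite lee_fin.
Qed.

(** The doubly indexed family of covering sets is enumerated along a bijection between nat and nat *
    nat; nonnegative double series may be rearranged. *)
Lemma has_cover_bigcup (R : realType) (s d : R) (E : nat -> set R)
    (c : nat -> R) (C : R) :
  (forall n, has_cover s d (E n) (c n)) ->
  (forall m, \sum_(i < m) c i <= C) ->
  has_cover s d (\bigcup_n E n) C.
Proof.
move=> /choice[U hU] hC.
have /card_esym/ppcard_eqP[f] := card_nat2.
pose g (p : nat * nat) := (powR (fine (diam (U p.1 p.2))) s)%:E.
have g0 p : (0 <= g p)%E by rewrite lee_fin powR_ge0.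
exists (fun k => U (f k).1 (f k).2); split.
- move=> x [n _ Enx]; have [+ _ _] := hU n; move=> /(_ _ Enx)[k _ Ux].
  by exists (f^-1%FUN (n, k)) => //=; rewrite invK ?inE.
- by move=> k; have [_ + _] := hU (f k).1; exact.
rewrite -[leLHS]/((\sum_(0 <= i <oo) ((g \o f) i))%E).
rewrite nneseries_esumT; last by move=> n; exact: g0.
have <- : (\esum_(p in [set: nat * nat]) g p = \esum_(i in [set: nat]) (g \o f) i)%E.
  by apply: reindex_esum => //; exact: bijTT.
have -> : [set: nat * nat] = setT `*`` (fun=> setT) by apply/seteqP; split.
rewrite (_ : g = fun p => g (p.1, p.2)); last by apply/funext => -[].
rewrite -(@esum_esum _ _ _ setT (fun=> setT) (fun n k => g (n, k))) //.
apply: (@le_trans _ _ (\sum_(0 <= n <oo) (c n)%:E)%E).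
  rewrite -nneseries_esumT; last by move=> n; apply: esum_ge0.
  apply: lee_nneseries => n; first by move=> _ _; apply: esum_ge0.
  move=> _.
  by rewrite -nneseries_esumT //; have [_ _] := hU n.
apply: lime_le.
  apply: is_cvg_nneseries => n _ _; rewrite lee_fin.
  have [_ _] := hU n; rewrite -lee_fin; apply: le_trans.
  by apply: nneseries_ge0 => i _ _; rewrite lee_fin powR_ge0.
by apply: nearW => m; rewrite big_mkord sumEFin lee_fin.
Qed.

(** The set itself, padded with empty sets: these cost 0 because [fine] of -oo is 0 and 0^s = 0 for
    s > 0. *)
Lemma has_cover_set (R : realType) (s d : R) (E : set R) (r : R) :
  0 < s -> 0 < d -> 0 <= r -> r <= d ->
  (forall x y, E x -> E y -> `|x - y| <= r) -> has_cover s d E (r `^ s).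
Proof.
move=> s0 d0 r0 rd hE.
have dE0 : diam (set0 : set R) = -oo%E.
  rewrite /diam (_ : [set _ | _ in _ & _ in _] = set0) ?ereal_sup0 //.
  by apply/seteqP; split => // z [x []].
exists (fun i => if i is 0%N then E else set0); split.
- by move=> x Ex; exists 0%N.
- case=> [|i]; last by rewrite dE0 leNye.
  by apply: (le_trans (diam_le hE)); rewrite lee_fin.
rewrite (nneseries_split _ 1); last by move=> k _; rewrite lee_fin powR_ge0.
rewrite [X in (_ + X)%E]eseries0 => [|[|k]// _ _]; last by rewrite dE0 /= powR0 // gt_eqF.
rewrite adde0 add0n big_nat1 lee_fin.
apply: ge0_ler_powR; rewrite ?nnegrE ?fine_diam_ge0 ?(ltW s0) //.
by apply: fine_diam_le => //; exact: diam_le.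
Qed.

Lemma has_cover_ge0 (R : realType) (s d : R) (E : set R) (c : R) :
  has_cover s d E c -> 0 <= c.
Proof.
move=> [U [_ _]]; rewrite -lee_fin; apply: le_trans.
by apply: nneseries_ge0 => i _ _; rewrite lee_fin powR_ge0.
Qed.

Lemma has_cover_set0 (R : realType) (s d c : R) :
  0 < s -> 0 < d -> 0 <= c -> has_cover s d set0 c.
Proof.
move=> s0 d0 c0.
apply: (@has_coverS _ _ _ _ set0 (0 `^ s)) => //.
  by rewrite powR0 // gt_eqF.
by apply: has_cover_set => //; exact: ltW.
Qed.

Lemma has_cover_bigcup_fin (R : realType) (s d : R) (m : nat) (E : nat -> set R)
    (c : nat -> R) :
  0 < s -> 0 < d -> (forall n, (n < m)%N -> has_cover s d (E n) (c n)) ->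
  has_cover s d (\bigcup_(n in `I_m) E n) (\sum_(i < m) c i).
Proof.
move=> s0 d0 h.
pose E' n := if (n < m)%N then E n else set0.
pose c' n := if (n < m)%N then c n else 0.
apply: (@has_coverS _ _ _ _ (\bigcup_n E' n) (\sum_(i < m) c i)) => //.
  by move=> x [n /= nm Ex]; exists n => //; rewrite /E' nm.
have c'0 n : 0 <= c' n.
  by rewrite /c'; case: ifPn => // nm; exact: has_cover_ge0 (h _ nm).
apply: (@has_cover_bigcup _ _ _ _ c') => [n|k].
  by rewrite /E' /c'; case: ifPn => [/h//|_]; exact: has_cover_set0.
have -> : \sum_(i < m) c i = \sum_(0 <= i < m) c' i.
  by rewrite big_mkord; apply: eq_bigr => i _; rewrite /c' ltn_ord.
rewrite -(big_mkord predT c').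
case: (leqP k m) => km.
  by rewrite (big_cat_nat (leq0n k) km) //= lerDl sumr_ge0.
rewrite (big_cat_nat (leq0n m) (ltnW km)) //= gerDl.
rewrite big_nat big1 // => i /andP[mi _].
by rewrite /c' ltnNge mi.
Qed.

Lemma has_cover_null_bigcup (R : realType) (s d : R) (E : nat -> set R) :
  (forall n e, 0 < e -> has_cover s d (E n) e) ->
  forall e, 0 < e -> has_cover s d (\bigcup_n E n) e.
Proof.
move=> h e e0.
apply: (@has_cover_bigcup _ _ _ _ (fun n => e / 2 ^+ n.+1)) => [n|m].
  by apply: h; rewrite divr_gt0 // exprn_gt0.
have -> : \sum_(i < m) e / 2 ^+ i.+1 = e - e / 2 ^+ m.
  elim: m => [|m ih]; first by rewrite big_ord0 expr0 divr1 subrr.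
  rewrite big_ord_recr /= ih exprS invfM; lra.
by rewrite gerBl divr_ge0 // ?exprn_ge0 // ltW.
Qed.

Lemma hausdorff_measure_eq0 (R : realType) (s : R) (E : set R) :
  (forall d e, 0 < d -> 0 < e -> has_cover s d E e) ->
  hausdorff_measure s E = 0%E.
Proof.
move=> h; rewrite /hausdorff_measure.
have h0 (d : R) : 0 < d -> hausdorff_content s d E = 0%E.
  move=> d0; apply/eqP; rewrite eq_le; apply/andP; split.
    apply/lee_addgt0Pr => e e0; rewrite add0e.
    have [U [EU dU sU]] := h _ _ d0 e0.
    by apply: le_trans sU; apply: ereal_inf_lbound; exists U.
  apply: le_ereal_inf_tmp => _ [U _ <-].
  by apply: nneseries_ge0 => i _ _; rewrite lee_fin powR_ge0.
have -> : [set hausdorff_content s delta E | delta in [set d : R | 0 < d]] = [set 0%E].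
  apply/seteqP; split => x /=; first by move=> [d /h0 -> <-].
  by move=> ->; exists 1 => //=; exact: h0.
by rewrite ereal_sup1.
Qed.

(* The mass distribution principle for the image under g of the Lebesgue measure on [0, 1). *)
Lemma hausdorff_measure_neq0 (R : realType) (s C : R) (E : set R) (g : R -> R) :
  0 < s -> 0 < C -> (forall t, 0 <= t < 1 -> E (g t)) ->
  (forall t u, 0 <= t < 1 -> 0 <= u < 1 -> `|t - u| <= C * `|g t - g u| `^ s) ->
  hausdorff_measure s E != 0%E.
Proof.
move=> s0 C0 gE hg.
suff h : ((2 * C)^-1%:E <= hausdorff_content s 1 E)%E.
  rewrite gt_eqF //; apply: lt_le_trans (ereal_sup_ubound _).
    by apply: lt_le_trans h; rewrite lte_fin invr_gt0 mulr_gt0.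
  by exists 1 => /=.
apply: le_ereal_inf_tmp => _ [U [EU dU] <-].
(* Two parameters sent into [U i] differ by at most C diam(U i)^s, so all of them lie in an interval
   of twice that length centred at one of them. These intervals cover [0, 1), whence the constant
   1/(2C). *)
have : forall i, exists I : interval R,
    (forall t, 0 <= t < 1 -> U i (g t) -> [set` I] t) /\
    (lebesgue_measure [set` I] <= (2 * C * (powR (fine (diam (U i))) s))%:E)%E.
  move=> i.
  have r0 : 0 <= C * (powR (fine (diam (U i))) s) by rewrite mulr_ge0 ?powR_ge0 ?ltW.
  have [[t [t01 Ut]]|nt] := pselect (exists t, 0 <= t < 1 /\ U i (g t)).
    exists `[t - C * (powR (fine (diam (U i))) s), t + C * (powR (fine (diam (U i))) s)]; split.
      move=> u u01 Uu /=; rewrite in_itv /= -ler_distl distrC.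
      apply: (le_trans (hg _ _ t01 u01)); rewrite ler_pM2l //.
      apply: ge0_ler_powR; rewrite ?nnegrE ?fine_diam_ge0 ?(ltW s0) //.
      exact: (le_diam (dU i)).
    rewrite lebesgue_measure_itv /= lte_fin.
    by case: ifPn => _; rewrite -?EFinB lee_fin; [lra|rewrite -mulrA mulr_ge0].
  exists `]0, 0[; split; first by move=> u u01 Uu; exfalso; apply: nt; exists u.
  by rewrite set_itvoo0 measure0 lee_fin -mulrA mulr_ge0.
move=> /choice[I hI].
have cov : `[0, 1[%classic `<=` \bigcup_i [set` I i].
  move=> t /=; rewrite in_itv /= => t01.
  by have [i _ Ui] := EU _ (gE _ t01); exists i => //; exact: (hI i).1.
have m1 : lebesgue_measure (`[0 : R, 1[%classic : set R) = 1%E.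
  by rewrite lebesgue_measure_itv /= lte_fin ltr01 oppr0 adde0.
have h1 : (1 <= \sum_(0 <= i <oo) lebesgue_measure ([set` I i] : set R))%E.
  by rewrite -m1; apply: measure_sigma_subadditive => // i; exact: measurable_itv.
rewrite -(@lee_pmul2l _ (2 * C)%:E) //; last by rewrite lte_fin mulr_gt0.
rewrite -EFinM mulfV; last by rewrite gt_eqF // mulr_gt0.
rewrite -nneseriesZl; last by move=> i _; rewrite lee_fin powR_ge0.
apply: (le_trans h1); apply: lee_nneseries => // i _.
by rewrite -EFinM; exact: (hI i).2.
Qed.

(** * Continued fractions *)

Definition cfdom (R : realType) : set R := [set x | 0 < x < 1 /\ Defs.irrational x].

Lemma inv_gauss (R : realType) (x : R) : x^-1 = (pq 1 x)%:~R + gauss x.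
Proof. by rewrite /pq /gauss /= addrC subrK. Qed.

Lemma pqS (R : realType) (n : nat) (x : R) : (1 <= n)%N -> pq n.+1 x = pq n (gauss x).
Proof. by case: n => // n _; rewrite /pq /= -iterSr. Qed.

Lemma irrational_gauss (R : realType) (x : R) : Defs.irrational x -> Defs.irrational (gauss x).
Proof.
move=> ix q hq; apply: (ix ((pq 1 x)%:~R + q)^-1).
apply: invr_inj.
by rewrite inv_gauss hq fmorphV invrK rmorphD /= ratr_int.
Qed.

Lemma cfdom_gauss (R : realType) (x : R) : cfdom x -> cfdom (gauss x).
Proof.
move=> [x01 ix]; have ig := irrational_gauss ix; split => //.
have g0 : gauss x != 0 by apply/eqP => g0; apply: (ig 0); rewrite rmorph0.
rewrite lt_neqAle eq_sym g0 /= /gauss subr_ge0 floor_le /=.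
by rewrite ltrBlDl -intrD1; exact: floorD1_gt.
Qed.

Lemma pq1_gt0 (R : realType) (x : R) : cfdom x -> 0 < pq 1 x.
Proof. by move=> [/andP[x0 x1] _]; rewrite floor_gt0 invf_ge1 // ltW. Qed.

(** The common integer part cancels, so the Gauss images differ by exactly 1/x - 1/y. *)
Lemma dist_gauss (R : realType) (x y : R) : cfdom x -> cfdom y -> pq 1 x = pq 1 y ->
  `|x - y| = x * y * `|gauss x - gauss y|.
Proof.
move=> [/andP[x0 _] _] [/andP[y0 _] _] e.
have -> : gauss x - gauss y = (y - x) / (x * y).
  have := inv_gauss x; have := inv_gauss y; rewrite e => ey ex.
  have -> : gauss x - gauss y = x^-1 - y^-1 by rewrite ex ey; ring.
  by field; rewrite !gt_eqF.
rewrite normrM normfV (gtr0_norm (mulr_gt0 x0 y0)) mulrCA mulfV ?mulr1 1?distrC //.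
by rewrite gt_eqF // mulr_gt0.
Qed.

Lemma le_inv_pq (R : realType) (x A : R) : cfdom x -> 0 < A -> A <= (pq 1 x)%:~R -> x <= A^-1.
Proof.
move=> cx A0 h; have [/andP[x0 _] _] := cx; have [/andP[g0 _] _] := cfdom_gauss cx.
rewrite -(invrK x) lef_pV2 ?posrE ?invr_gt0 // inv_gauss; lra.
Qed.

Lemma ge_inv_pq (R : realType) (x B : R) : cfdom x -> (pq 1 x)%:~R + 1 <= B -> B^-1 <= x.
Proof.
move=> cx h; have [/andP[x0 _] _] := cx; have [/andP[g0 g1] _] := cfdom_gauss cx.
have : (0 : R) < (pq 1 x)%:~R by rewrite ltr0z pq1_gt0.
move=> p0; rewrite -[leRHS](invrK x) lef_pV2 ?posrE ?invr_gt0 // ?inv_gauss; lra.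
Qed.

(** By [dist_gauss], each shared digit contracts the distance by x y, and both factors are at most
    1/A. *)
Lemma cf_dist_le (R : realType) (m : nat) (A : nat -> R) (x y : R) :
  cfdom x -> cfdom y ->
  (forall i, (i < m)%N -> pq i.+1 x = pq i.+1 y /\ 0 < A i.+1 <= (pq i.+1 x)%:~R) ->
  `|x - y| <= \prod_(i < m) (A i.+1)^-2.
Proof.
elim: m => [|m ih] in A x y *.
  move=> [/andP[x0 x1] _] [/andP[y0 y1] _] _.
  by rewrite big_ord0 ler_norml; apply/andP; split; lra.
move=> cx cy h; have [e /andP[A0 Ax]] := h 0%N isT.
rewrite dist_gauss // big_ord_recl /=.
have [[/andP[x0 _] _] [/andP[y0 _] _]] := (cx, cy).
apply: ler_pM; rewrite ?mulr_ge0 ?(ltW x0) ?(ltW y0) //.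
  rewrite -exprVn expr2; apply: ler_pM; rewrite ?(ltW x0) ?(ltW y0) //.
    exact: le_inv_pq.
  by apply: le_inv_pq => //; rewrite -e.
apply: (ih (fun i => A i.+1)); [exact: cfdom_gauss|exact: cfdom_gauss|].
by move=> i im; rewrite -!pqS //; exact: h.
Qed.

(** The first digit of y is larger by at least 1 and gauss x < 1, so 1/y - 1/x is at least gauss y,
    which the second digit of y keeps away from 0. *)
Lemma cf_dist_ge_first (R : realType) (A B x y : R) :
  cfdom x -> cfdom y -> pq 1 x < pq 1 y ->
  (pq 1 x)%:~R + 1 <= A -> (pq 1 y)%:~R + 1 <= A -> (pq 2 y)%:~R + 1 <= B ->
  A^-2 * B^-1 <= `|x - y|.
Proof.
move=> cx cy h hx hy hB.
have [[/andP[x0 _] _] [/andP[y0 _] _]] := (cx, cy).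
have Bg : B^-1 <= gauss y.
  by apply: ge_inv_pq; [exact: cfdom_gauss|rewrite -pqS].
have [/andP[_ gx1] _] := cfdom_gauss cx.
have Ax := ge_inv_pq cx hx; have Ay := ge_inv_pq cy hy.
have A0 : 0 < A.
  have : (0 : R) < (pq 1 x)%:~R by rewrite ltr0z pq1_gt0.
  lra.
have B0 : 0 < B.
  have : (0 : R) < (pq 2 y)%:~R by rewrite ltr0z pqS // pq1_gt0 //; exact: cfdom_gauss.
  lra.
have h' : (pq 1 x)%:~R + 1 <= (pq 1 y)%:~R :> R by rewrite -intrD1 ler_int lezD1.
have -> : x - y = x * y * (y^-1 - x^-1) by field; rewrite !gt_eqF.
have BV : 0 <= B^-1 by rewrite invr_ge0 ltW.
have AV : 0 <= A^-1 by rewrite invr_ge0 ltW.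
have d : B^-1 <= y^-1 - x^-1 by rewrite (inv_gauss x) (inv_gauss y); lra.
rewrite normrM (gtr0_norm (mulr_gt0 x0 y0)) ger0_norm; last exact: le_trans d.
apply: ler_pM => //; first by rewrite -exprVn exprn_ge0.
by rewrite -exprVn expr2; apply: ler_pM.
Qed.

(** Shared digits are removed by [dist_gauss] until the first digits differ. The last factor bounds
    the digit just after the first disagreement, as in [cf_dist_ge_first]. *)
Lemma cf_dist_ge (R : realType) (m : nat) (B : nat -> R) (x y : R) :
  cfdom x -> cfdom y ->
  (forall i, (pq i.+1 x)%:~R + 1 <= B i.+1 /\ (pq i.+1 y)%:~R + 1 <= B i.+1) ->
  (forall i, (i < m)%N -> pq i.+1 x = pq i.+1 y) -> pq m.+1 x <> pq m.+1 y ->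
  (\prod_(i < m.+1) (B i.+1)^-2) * (B m.+2)^-1 <= `|x - y|.
Proof.
elim: m => [|m ih] in B x y *.
  move=> cx cy hB _ /eqP; rewrite neq_lt => /orP[h|h]; rewrite big_ord1.
    by apply: cf_dist_ge_first => //; [exact: (hB 0%N).1|exact: (hB 0%N).2|exact: (hB 1%N).2].
  rewrite distrC.
  by apply: cf_dist_ge_first => //; [exact: (hB 0%N).2|exact: (hB 0%N).1|exact: (hB 1%N).1].
move=> cx cy hB e ne.
rewrite dist_gauss ?(e 0%N) // big_ord_recl -mulrA.
have [hx hy] := hB 0%N.
have Ax := ge_inv_pq cx hx; have Ay := ge_inv_pq cy hy.
have B0 i : 0 <= B i.+1.
  apply: le_trans (hB i).1.
  have : 0 <= pq i.+1 x.
    elim: i (x) cx => [|i ihi] z cz; first by rewrite ltW // pq1_gt0.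
    by rewrite pqS //; apply: ihi; exact: cfdom_gauss.
  by rewrite -(ler0z R) => ?; lra.
apply: ler_pM.
- by rewrite -exprVn exprn_ge0 // invr_ge0; exact: B0.
- rewrite mulr_ge0 ?invr_ge0 ?B0 //.
  by apply: prodr_ge0 => i _; rewrite invr_ge0 exprn_ge0 //; exact: B0.
- by rewrite -exprVn expr2; apply: ler_pM; rewrite ?invr_ge0 ?B0.
apply: (ih (fun i => B i.+1)); [exact: cfdom_gauss|exact: cfdom_gauss| | |].
- by move=> i; rewrite -!pqS //; exact: hB.
- by move=> i im; rewrite -!pqS //; exact: e.
- by rewrite -!pqS.
Qed.

(** * Points with prescribed partial quotients *)

Lemma exists_exprN_lt (R : realType) (e : R) : 0 < e -> exists n, 4 ^- n < e.
Proof.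
move=> e0; exists (Num.bound e^-1).
rewrite -[ltRHS]invrK ltf_pV2 ?posrE ?invr_gt0 ?exprn_gt0 //.
apply: (lt_le_trans (archi_boundP _)); first by rewrite invr_ge0 ltW.
by rewrite -natrX ler_nat ltnW // ltn_expl.
Qed.

Fixpoint cf_conv (R : realType) (n : nat) (a : nat -> nat) : R :=
  if n is n'.+1 then ((a 0%N)%:R + cf_conv R n' (fun i => a i.+1))^-1 else 0.

Lemma cf_conv_itv (R : realType) (n : nat) (a : nat -> nat) :
  (forall i, 2 <= a i)%N -> 0 <= cf_conv R n a <= 1.
Proof.
elim: n a => [|n ih] a ha /=; first by rewrite lexx ler01.
have /andP[h0 h1] := ih (fun i => a i.+1) (fun i => ha i.+1).
have a2 : (2 : R) <= (a 0%N)%:R by rewrite ler_nat.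
by rewrite invr_ge0 invf_le1; [apply/andP; split; lra|lra].
Qed.

(** Both denominators are at least 2. This is how digits at least 2 make the convergents approach
    their limit at rate 4^(-n). *)
Lemma dist_inv_shift (R : realType) (a u v : R) : 2 <= a -> 0 <= u -> 0 <= v ->
  `|(a + u)^-1 - (a + v)^-1| <= `|u - v| / 4.
Proof.
move=> a2 u0 v0.
have -> : (a + u)^-1 - (a + v)^-1 = (v - u) / ((a + u) * (a + v)).
  by field; apply/andP; split; apply: lt0r_neq0; lra.
rewrite normrM distrC; apply: ler_wpM2l => //.
have p : 4 <= (a + u) * (a + v) by nra.
rewrite normfV ger0_norm; last by lra.
by rewrite lef_pV2 ?posrE //; lra.
Qed.

Lemma cf_conv_cauchy (R : realType) (n m : nat) (a : nat -> nat) :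
  (forall i, 2 <= a i)%N -> `|cf_conv R (n + m) a - cf_conv R n a| <= 4 ^- n.
Proof.
elim: n a => [|n ih] a ha.
  have /andP[h0 h1] := cf_conv_itv R m ha.
  by rewrite add0n /= subr0 ger0_norm // expr0 invr1.
rewrite addSn /=.
have a2 : (2 : R) <= (a 0%N)%:R by rewrite ler_nat.
have ha' i : (2 <= a i.+1)%N by exact: ha.
have /andP[h0 _] := cf_conv_itv R (n + m) ha'.
have /andP[h1 _] := cf_conv_itv R n ha'.
apply: (le_trans (dist_inv_shift a2 h0 h1)).
by rewrite exprS invfM mulrC ler_pM2l ?ih // invr_gt0.
Qed.

(** Every left endpoint of an interval of radius 4^(-n) around a convergent lies below every right
    endpoint, so the supremum of the left endpoints belongs to all these intervals. *)
Lemma cf_limit (R : realType) (a : nat -> nat) : (forall i, 2 <= a i)%N ->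
  exists x : R, forall n, `|x - cf_conv R n a| <= 4 ^- n.
Proof.
move=> ha.
pose S := [set cf_conv R n a - 4 ^- n | n in [set: nat]].
have ub n : ubound S (cf_conv R n a + 4 ^- n).
  move=> _ [m _ <-]; rewrite lerBlDr -addrA -lerBlDl.
  have [nm|mn] := leqP n m.
    have := cf_conv_cauchy R n (m - n) ha; rewrite subnKC // => h.
    apply: (le_trans (ler_norm _)); apply: (le_trans h).
    by rewrite lerDl invr_ge0 exprn_ge0.
  have := cf_conv_cauchy R m (n - m) ha; rewrite subnKC ?(ltnW mn) // distrC => h.
  apply: (le_trans (ler_norm _)); apply: (le_trans h).
  by rewrite lerDr invr_ge0 exprn_ge0.
exists (sup S) => n; rewrite ler_distl; apply/andP; split.
  apply: sup_ubound; last by exists n.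
  by exists (cf_conv R 0 a + 4 ^- 0).
apply: ge_sup; last exact: ub.
by exists (cf_conv R 0 a - 4 ^- 0); exists 0%N.
Qed.

(** The Euclidean algorithm: the Gauss map sends p/q to (q mod p)/p, so the numerators decrease
    until the orbit reaches 0. *)
Lemma rational_gauss_orbit (R : realType) (p q : nat) (x : R) :
  x = p%:R / q%:R -> ~ (forall n, 0 < iter n (@gauss R) x < 1).
Proof.
elim/ltn_ind: p q x => p ih q x ex h.
have /andP[x0 _] := h 0%N; rewrite /= in x0.
have p0 : (0 < p)%N.
  by case: p ex {ih} => // ex; move: x0; rewrite ex mul0r ltxx.
apply: (ih (q %% p)%N (ltn_pmod _ p0) p (gauss x)); last first.
  by move=> n; rewrite -iterSr.
have p0R : (0 : R) < p%:R by rewrite ltr0n.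
have e : x^-1 = (q %/ p)%:R + (q %% p)%:R / p%:R.
  rewrite ex invf_div {1}(divn_eq q p) natrD natrM; field.
  by rewrite gt_eqF.
rewrite /gauss e.
have -> : Num.floor ((q %/ p)%:R + (q %% p)%:R / p%:R : R) = (q %/ p)%:Z.
  apply: floor_def; rewrite intrD1 -!pmulrn lerDl divr_ge0 //= ltrD2l ltr_pdivrMr // mul1r.
  by rewrite ltr_nat ltn_pmod.
by rewrite -pmulrn addrC addKr.
Qed.

Lemma irrational_gauss_orbit (R : realType) (x : R) :
  (forall n, 0 < iter n (@gauss R) x < 1) -> Defs.irrational x.
Proof.
move=> h r xr.
have /andP[x0 _] := h 0%N; rewrite /= in x0.
have r0 : 0 < r by move: x0; rewrite xr ltr0q.
apply: (@rational_gauss_orbit _ `|numq r|%N `|denq r|%N x) => //.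
by rewrite xr /ratr !natr_absz !gtr0_norm ?denq_gt0 ?numq_gt0.
Qed.

Lemma cf_exists (R : realType) (a : nat -> nat) : (forall i, 2 <= a i)%N ->
  exists x : R, cfdom x /\ forall n, pq n.+1 x = (a n)%:Z.
Proof.
(* Bundling the sequences with their bound lets the shift act on one type, and limits are chosen for
   all sequences at once. *)
pose T := {a : nat -> nat | forall i, (2 <= a i)%N}.
pose sh (a : T) : T := exist (fun a => forall i, (2 <= a i)%N) (fun i => sval a i.+1) (fun i => svalP a i.+1).
have [X hX] : {X : T -> R & forall (a : T) n, `|X a - cf_conv R n (sval a)| <= 4 ^- n}.
  apply: (@choice _ _ (fun (a : T) x => forall n, `|x - cf_conv R n (sval a)| <= 4 ^- n)).
  by move=> -[b hb] /=; exact: cf_limit.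
have X0 (b : T) : 0 <= X b.
  rewrite leNgt; apply/negP => Xb.
  have [|n hn] := @exists_exprN_lt _ (- X b); first by rewrite oppr_gt0.
  have /andP[c0 _] := cf_conv_itv R n (svalP b).
  have := hX b n; rewrite ler_distl => /andP[+ _]; lra.
(* The recursion of the convergents passes to the limit. Hence the Gauss map acts on the values
   [X b] as the shift, and the digits can be read off. *)
have XE (b : T) : X b = ((sval b 0%N)%:R + X (sh b))^-1.
  apply/eqP; rewrite -subr_eq0 -normr_le0 leNgt; apply/negP => Xb.
  have [n] := exists_exprN_lt Xb; apply/negP; rewrite -leNgt.
  apply: (le_trans (ler_distD (cf_conv R n.+1 (sval b)) _ _)).
  have b2 : (2 : R) <= (sval b 0%N)%:R by rewrite ler_nat; exact: (svalP b).
  have /andP[c0 _] := cf_conv_itv R n (svalP (sh b)).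
  have h1 := hX b n.+1; rewrite exprS invfM in h1.
  have h2 := dist_inv_shift b2 c0 (X0 (sh b)).
  have h3 := hX (sh b) n; rewrite distrC in h3.
  rewrite /= in h1 h2 h3 *.
  have := exprn_ge0 n (ler0n R 4); rewrite -invr_ge0.
  lra.
have X01 (b : T) : 0 < X b < 1.
  have b2 (c : T) : (2 : R) <= (sval c 0%N)%:R by rewrite ler_nat; exact: (svalP c).
  have := b2 b; have := X0 (sh b) => h h'.
  by rewrite XE invr_gt0 invf_lt1; [apply/andP; split; lra|lra].
have fX (b : T) : Num.floor (X b)^-1 = (sval b 0%N)%:Z.
  rewrite XE invrK; apply: floor_def; have /andP[u0 u1] := X01 (sh b).
  by rewrite intrD1 -!pmulrn lerDl ltrD2l u1 ltW.
have gX (b : T) : gauss (X b) = X (sh b).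
  by rewrite /gauss fX XE invrK -pmulrn addrC addKr.
have iX n (b : T) : exists c : T, iter n (@gauss R) (X b) = X c /\ sval c 0%N = sval b n.
  elim: n b => [|n ih] b; first by exists b.
  by have [c [e1 e2]] := ih (sh b); exists c; rewrite iterSr gX e1 e2.
move=> ha; pose b : T := exist (fun a => forall i, (2 <= a i)%N) a ha.
exists (X b); split; last by move=> n; rewrite /pq /=; have [c [-> e]] := iX n b; rewrite fX e.
split; first exact: X01.
by apply: irrational_gauss_orbit => n; have [c [-> _]] := iX n b; exact: X01.
Qed.

(** * Free positions and their weights *)

Definition spread (sigma : nat -> nat) : Prop :=
  forall n, (1 <= n)%N -> (0 < sigma n)%N /\ (sigma n + n <= sigma n.+1)%N.

(** The gaps sum to at least n(n-1)/2, so sigma grows quadratically: a block is short compared with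
    its position. *)
Lemma spread_ge (sigma : nat -> nat) (n : nat) :
  spread sigma -> (1 <= n)%N -> (n <= sigma n /\ n * n <= 3 * sigma n)%N.
Proof.
move=> hs; elim: n => // -[|n] ih _.
  by have [] := hs 1%N isT; lia.
have [h1 h2] := hs n.+1 isT.
by have [] := ih isT; nia.
Qed.

Lemma spread_le (sigma : nat -> nat) (m n : nat) :
  spread sigma -> (1 <= m)%N -> (m < n)%N -> (sigma m + m <= sigma n)%N.
Proof.
move=> hs m1; elim: n => // n ih; rewrite ltnS leq_eqVlt => /orP[/eqP <-|mn].
  by have [] := hs m m1.
by have := ih mn; have [] := hs n (leq_ltn_trans (leq0n m) mn); lia.
Qed.

Lemma spread_bracket (sigma : nat -> nat) (N j : nat) :
  spread sigma -> (1 <= N)%N -> (sigma N <= j)%N ->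
  exists2 n, (N <= n)%N & (sigma n <= j < sigma n.+1)%N.
Proof.
move=> hs N1; elim: j => [|j ih].
  by have [+ _] := hs N N1; case: (sigma N).
rewrite leq_eqVlt => /orP[/eqP e|/ih[n Nn /andP[h1 h2]]].
  by exists N => //; have [_] := hs N N1; lia.
have [h|h] := ltnP j.+1 (sigma n.+1); first by exists n => //; lia.
by exists n.+1; [lia|have [_] := hs n.+1 isT; lia].
Qed.

Definition in_block (sigma : nat -> nat) (n i : nat) : bool :=
  [&& (0 < n)%N, (sigma n <= i)%N & (i < sigma n + n)%N].

(** Searching only n <= i makes this decidable and loses no block of a spread sequence, where n <=
    sigma n. *)
Definition free_pos (sigma : nat -> nat) (i : nat) : bool :=
  ~~ [exists n : 'I_i.+1, in_block sigma n i].

Lemma in_block_not_free (sigma : nat -> nat) (n i : nat) :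
  spread sigma -> in_block sigma n i -> ~~ free_pos sigma i.
Proof.
move=> hs b; rewrite negbK; apply/existsP.
have /and3P[n0 h1 h2] := b.
have ni : (n < i.+1)%N by have [] := spread_ge hs n0; lia.
by exists (Ordinal ni).
Qed.

Lemma in_block_inj (sigma : nat -> nat) (m n i : nat) :
  spread sigma -> in_block sigma m i -> in_block sigma n i -> m = n.
Proof.
move=> hs /and3P[m0 h1 h2] /and3P[n0 h3 h4].
by have [mn|mn|//] := ltngtP m n; have := spread_le hs _ mn; lia.
Qed.

Lemma free_between (sigma : nat -> nat) (n i : nat) :
  spread sigma -> (1 <= n)%N -> (sigma n + n <= i < sigma n.+1)%N -> free_pos sigma i.
Proof.
move=> hs n1 /andP[h1 h2]; apply/negP => /existsP[m /and3P[m0 h3 h4]].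
have [mn|mn|e] := ltngtP m n.
- by have := spread_le hs m0 mn; lia.
- have [e|nm] := eqVneq (m : nat) n.+1; first by move: h3; rewrite e; lia.
  have n1m : (n.+1 < m)%N by lia.
  by have := spread_le hs (isT : (0 < n.+1)%N) n1m; lia.
- by move: h4; rewrite e; lia.
Qed.

(** This counts the binary digits of the parameter used up before position j, since a free digit at
    i has 2^i choices. *)
Definition free_weight (sigma : nat -> nat) (j : nat) : nat :=
  \sum_(i < j) (if free_pos sigma i then i : nat else 0).

Definition block_weight (sigma : nat -> nat) (j : nat) : nat :=
  \sum_(i < j) (if free_pos sigma i then 0 else i : nat).

Lemma free_weightS (sigma : nat -> nat) (j : nat) :
  free_weight sigma j.+1 = (free_weight sigma j + (if free_pos sigma j then j else 0))%N.
Proof. by rewrite /free_weight big_ord_recr. Qed.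

Lemma block_weightS (sigma : nat -> nat) (j : nat) :
  block_weight sigma j.+1 = (block_weight sigma j + (if free_pos sigma j then 0 else j))%N.
Proof. by rewrite /block_weight big_ord_recr. Qed.

Lemma weightD (sigma : nat -> nat) (j : nat) :
  (2 * (free_weight sigma j + block_weight sigma j) + j = j * j)%N.
Proof.
elim: j => [|j ih]; first by rewrite /free_weight /block_weight !big_ord0.
by rewrite free_weightS block_weightS; case: ifP => _; nia.
Qed.

Lemma block_weight_homo (sigma : nat -> nat) (i j : nat) :
  (i <= j)%N -> (block_weight sigma i <= block_weight sigma j)%N.
Proof.
move=> ij; rewrite -(subnKC ij); elim: (j - i)%N => [|k ih]; first by rewrite addn0.
by rewrite addnS block_weightS; apply: (leq_trans ih); rewrite leq_addr.
Qed.

(** At most n positions of the group are not free, from sigma n to sigma n + n - 1; they sum to n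
    sigma n + n(n-1)/2. *)
Lemma block_weight_step (sigma : nat -> nat) (n : nat) :
  spread sigma -> (1 <= n)%N ->
  (2 * block_weight sigma (sigma n.+1) + n
     <= 2 * block_weight sigma (sigma n) + 2 * n * sigma n + n * n)%N.
Proof.
move=> hs n1; have [s0 s1] := hs n n1.
have h k : (2 * block_weight sigma (sigma n + k) + k
    <= 2 * block_weight sigma (sigma n) + 2 * k * sigma n + k * k)%N.
  elim: k => [|k ih]; first by rewrite muln0 mul0n !addn0.
  by rewrite (addnS (sigma n) k) block_weightS; case: ifP => _; nia.
have e k : (k <= sigma n.+1 - (sigma n + n))%N ->
    block_weight sigma (sigma n + n + k) = block_weight sigma (sigma n + n).
  elim: k => [|k ih] hk; first by rewrite addn0.
  rewrite addnS block_weightS (@free_between _ n) // ?addn0; first by apply: ih; lia.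
  lia.
by rewrite -(subnKC s1) e //; exact: h.
Qed.

(* A progression comes first in its group [sigma n, sigma n.+1), where the weights i are
   smallest, so its share of the weight is at most its share theta of the positions. *)
Lemma block_weight_le (R : realType) (sigma : nat -> nat) (theta : R) (N : nat) :
  spread sigma -> (1 <= N)%N -> 0 <= theta ->
  (forall n, (N <= n)%N -> n%:R <= theta * (sigma n.+1 - sigma n)%:R) ->
  forall n, (N <= n)%N ->
    2 * (block_weight sigma (sigma n))%:R <=
    2 * (block_weight sigma (sigma N))%:R + theta * (sigma n)%:R ^+ 2 - theta * (sigma n)%:R :> R.
Proof.
move=> hs N1 th0 hth n Nn; rewrite -(subnKC Nn); elim: (n - N)%N => [|k ih].
  have [_ h] := spread_ge hs N1; have [s0 _] := hs N N1.
  have s1 : (1 : R) <= (sigma N)%:R by rewrite ler1n.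
  rewrite addn0 -addrA lerDl -mulrBr mulr_ge0 // subr_ge0 expr2.
  by rewrite ler_peMr // ler0n.
rewrite addnS; move: ih; set p := (N + k)%N => ih.
have p1 : (1 <= p)%N by rewrite /p; lia.
have Np : (N <= p)%N by rewrite /p; lia.
clearbody p.
have := hth p Np; have := block_weight_step hs p1.
have [_ sp] := hs p p1.
rewrite -(ler_nat R) !natrD !natrM => hb.
rewrite natrB; last by lia.
move: sp; rewrite -(ler_nat R) natrD.
move: p1; rewrite -(ler1n R).
move: hb ih.
set a := (block_weight _ (sigma p.+1))%:R; set b := (block_weight _ (sigma p))%:R.
set u := (sigma p)%:R; set v := (sigma p.+1)%:R; set q := p%:R.
move=> hb ih q1 uv qv.
have u0 : 0 <= u by rewrite ler0n.
have h1 : q * u <= theta * (v - u) * u by rewrite ler_wpM2r.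
have h2 : q * (q - 1) <= theta * (v - u) * (q - 1) by rewrite ler_wpM2r //; lra.
have h3 : theta * (v - u) * (q - 1) <= theta * (v - u) * (v - u - 1).
  by rewrite ler_wpM2l //; [rewrite mulr_ge0 //; lra|lra].
nra.
Qed.

(** Blocks take about theta j^2 / 2 of the total weight j^2 / 2, and (1 - theta)/2 > s leaves room
    for terms of lower order. The quadratic on the left is the exponent of [cf_dist_ge_pow2]. *)
Lemma free_weight_ge (R : realType) (sigma : nat -> nat) (s theta : R) (N : nat) :
  spread sigma -> (1 <= N)%N -> 0 <= theta -> 0 < s -> theta < 1 - 2 * s ->
  (forall n, (N <= n)%N -> n%:R <= theta * (sigma n.+1 - sigma n)%:R) ->
  exists K : R, forall j : nat,
    s * (j%:R ^+ 2 + 4 * j%:R + 2) <= (free_weight sigma j)%:R + K.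
Proof.
move=> hs N1 th0 s0 ths hth.
(* Half of the slack k pays for the block that j may cut, the other half for the terms linear in
   j. *)
pose k := 1 - 2 * s - theta; have k0 : 0 < k by rewrite /k; lra.
pose K0 : R := 2 * (block_weight sigma (sigma N))%:R.
have K00 : 0 <= K0 by rewrite /K0 mulr_ge0.
have hB j : 2 * (block_weight sigma j)%:R <=
    K0 + theta * j%:R ^+ 2 + k / 2 * j%:R ^+ 2 + (6 / k + 3) * j%:R :> R.
  have j0 : (0 : R) <= j%:R by rewrite ler0n.
  have kV : 0 < k^-1 by rewrite invr_gt0.
  have [jN|Nj] := ltnP j (sigma N).
    have := block_weight_homo sigma (ltnW jN); rewrite -(ler_nat R) -/K0 => h.
    have h1 : 0 <= theta * j%:R ^+ 2 by rewrite mulr_ge0 // exprn_ge0.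
    have h2 : 0 <= k / 2 * j%:R ^+ 2 by rewrite mulr_ge0 ?exprn_ge0 // divr_ge0 // ltW.
    have h3 : 0 <= (6 / k + 3) * j%:R by rewrite mulr_ge0 //; lra.
    by rewrite /K0; lra.
  have [n Nn /andP[h1 h2]] := spread_bracket hs N1 Nj.
  have n1 : (1 <= n)%N := leq_trans N1 Nn.
  have hA := block_weight_le hs N1 th0 hth Nn; rewrite -/K0 in hA.
  have hM := block_weight_homo sigma (ltnW h2).
  have hS := block_weight_step hs n1.
  have [_ hn] := spread_ge hs n1.
  move: hM hS hn h1; rewrite -!(ler_nat R) !natrD !natrM.
  set a := (block_weight _ j)%:R; set b := (block_weight _ (sigma n))%:R in hA *.
  set a' := (block_weight _ (sigma n.+1))%:R.
  set u := (sigma n)%:R in hA *; set q := n%:R; set J := j%:R in j0 *.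
  move=> hM hS hn uJ.
  have q1 : 1 <= q by rewrite ler1n.
  have u0 : 0 <= u by rewrite ler0n.
  have hu : theta * u ^+ 2 <= theta * J ^+ 2 by rewrite ler_wpM2l // ler_sqr ?nnegrE.
  have hu' : 0 <= theta * u by rewrite mulr_ge0.
  (* From q^2 <= 3 sigma n <= 3J the block length is of order sqrt(J); completing the square in q -
     6/k makes this linear with a small coefficient. *)
  have hq : 2 * q <= k / 2 * J + 6 / k.
    have e : k * k^-1 = 1 by rewrite mulfV // gt_eqF.
    have := sqr_ge0 (q - 6 / k).
    have -> : (q - 6 / k) ^+ 2 = q * q - 12 * q / k + 36 / k / k by ring.
    move=> h; suff : k / 6 * (12 * q / k) <= k / 6 * (3 * J + 36 / k / k).
      have -> : k / 6 * (12 * q / k) = 2 * q * (k * k^-1) by field; rewrite gt_eqF.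
      have -> : k / 6 * (3 * J + 36 / k / k) = k / 2 * J + 6 / k * (k * k^-1) by field; rewrite gt_eqF.
      by rewrite e; lra.
    by rewrite ler_wpM2l //; [lra|lra].
  have hqu : 2 * q * u <= (k / 2 * J + 6 / k) * J.
    by apply: ler_pM => //; lra.
  lra.
pose c := 6 / k + 4 + 8 * s.
exists ((K0 + 4 * s + c ^+ 2 / (2 * k)) / 2) => j.
have := hB j; have /(congr1 (fun n => n%:R : R)) := weightD sigma j.
rewrite natrD !natrM natrD.
set J := j%:R; set a := (free_weight _ _)%:R; set b := (block_weight _ _)%:R.
move=> e hb.
have hc : c * J <= k / 2 * J ^+ 2 + c ^+ 2 / (2 * k).
  have := sqr_ge0 (k * J - c).
  have -> : (k * J - c) ^+ 2 = (k ^+ 2 * J ^+ 2 + c ^+ 2) - 2 * k * (c * J) by ring.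
  rewrite subr_ge0 => h.
  rewrite -(@ler_pM2l _ (2 * k)); last by lra.
  apply: (le_trans h).
  rewrite le_eqVlt; apply/orP; left; apply/eqP; field.
  by rewrite gt_eqF.
have hk : k * J ^+ 2 = J ^+ 2 - 2 * s * J ^+ 2 - theta * J ^+ 2 by rewrite /k; ring.
have hcJ : c * J = 6 / k * J + 4 * J + 8 * (s * J) by rewrite /c; ring.
rewrite -expr2 in e; clearbody c k; set z := c ^+ 2 / (2 * k) in hc *; lra.
Qed.

(** * The lower bound *)

(* On block n the digits form the progression with first term and difference 2^(sigma n). *)
Definition block_digit (sigma : nat -> nat) (c : nat -> nat) (i : nat) : nat :=
  if [pick n : 'I_i.+1 | in_block sigma n i] is Some n
  then ((i - sigma n).+1 * 2 ^ sigma n)%N else (2 ^ i + c i %% 2 ^ i)%N.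

Lemma block_digit_in (sigma : nat -> nat) c (n i : nat) :
  spread sigma -> in_block sigma n i ->
  block_digit sigma c i = ((i - sigma n).+1 * 2 ^ sigma n)%N.
Proof.
move=> hs b; rewrite /block_digit; case: pickP => [m bm|h].
  by rewrite (in_block_inj hs bm b).
by have /existsP[m bm] := negPn (in_block_not_free hs b); rewrite h in bm.
Qed.

Lemma block_digit_free (sigma : nat -> nat) c (i : nat) :
  free_pos sigma i -> block_digit sigma c i = (2 ^ i + c i %% 2 ^ i)%N.
Proof.
move=> f; rewrite /block_digit; case: pickP => // m bm.
by move: f; rewrite /free_pos => /existsP[]; exists m.
Qed.

Lemma free_or_block (sigma : nat -> nat) (i : nat) :
  free_pos sigma i \/ exists n, in_block sigma n i.
Proof.
have [f|/negPn/existsP[n b]] := boolP (free_pos sigma i); first by left.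
by right; exists n.
Qed.

Lemma block_digit_lt (sigma : nat -> nat) c (i : nat) :
  spread sigma -> (block_digit sigma c i < 2 ^ i.+1)%N.
Proof.
move=> hs; have [f|[n b]] := free_or_block sigma i.
  by rewrite block_digit_free // expnS mul2n -addnn ltn_add2l ltn_pmod // expn_gt0.
rewrite (block_digit_in _ hs b); have /and3P[_ h _] := b.
rewrite -{2}(subnK h) -addSn expnD ltn_pmul2r ?expn_gt0 //.
exact: ltn_expl.
Qed.

Lemma block_digit_ge2 (sigma : nat -> nat) c (i : nat) :
  spread sigma -> (1 <= i)%N -> (2 <= block_digit sigma c i)%N.
Proof.
move=> hs i1; have [f|[n b]] := free_or_block sigma i.
  rewrite block_digit_free //; apply: leq_trans (leq_addr _ _).
  by rewrite -{1}(expn1 2) leq_exp2l.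
rewrite (block_digit_in _ hs b); have /and3P[n0 h _] := b.
have [s0 _] := hs n n0.
apply: (@leq_trans (1 * 2 ^ sigma n)); last by rewrite leq_mul2r orbT.
by rewrite mul1n -{1}(expn1 2) leq_exp2l.
Qed.

(** A digit at i + 1 that is free or opens a block is at least 2^(i+1), which exceeds digit i by
    [block_digit_lt]; inside a block the multiples increase. *)
Lemma block_digit_incr (sigma : nat -> nat) c (i : nat) :
  spread sigma -> (block_digit sigma c i < block_digit sigma c i.+1)%N.
Proof.
move=> hs; have lt := block_digit_lt c i hs.
have [f|[n b]] := free_or_block sigma i.+1.
  by apply: (leq_trans lt); rewrite block_digit_free // leq_addr.
have /and3P[n0 h1 h2] := b.
have [e|ne] := eqVneq (sigma n) i.+1.
  by apply: (leq_trans lt); rewrite (block_digit_in _ hs b) e subnn mul1n.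
have b' : in_block sigma n i by apply/and3P; split => //; lia.
rewrite (block_digit_in _ hs b) (block_digit_in _ hs b') ltn_pmul2r ?expn_gt0 //.
lia.
Qed.

Lemma block_digit_Gset (R : realType) (sigma : nat -> nat) c (x : R) :
  spread sigma -> cfdom x ->
  (forall n, pq n.+1 x = (block_digit sigma c n.+1)%:Z) -> Gset sigma x.
Proof.
move=> hs [x01 ix] hx; split.
  split => //; split => //.
  by case=> // n _; rewrite !hx ltz_nat block_digit_incr.
exists 1%N => n n1 i hi.
have [s0 _] := hs n n1.
have hp k : (k < n)%N -> pq (sigma n + k) x = (k.+1 * 2 ^ sigma n)%N%:Z.
  move=> kn; have b : in_block sigma n (sigma n + k) by apply/and3P; split => //; lia.
  have := hx (sigma n + k).-1; rewrite prednK; last by lia.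
  by rewrite (block_digit_in _ hs b) addKn.
rewrite -!addnS -[in pq (sigma n) x](addn0 (sigma n)) -[in (sigma n).+1](addn0 (sigma n)).
rewrite -addnS !hp; lia.
Qed.

Lemma truncn_mul_div (R : realType) (y : R) (m : nat) : 0 <= y -> (0 < m)%N ->
  (Num.trunc (m%:R * y) %/ m)%N = Num.trunc y.
Proof.
move=> y0 m0; apply/esym; apply: truncn_def.
have mR : (0 : R) < m%:R by rewrite ltr0n.
have /andP[h1 h2] := truncn_itv (mulr_ge0 (ltW mR) y0).
apply/andP; split.
  rewrite -(ler_pM2l mR); apply: le_trans h1.
  by rewrite -natrM ler_nat mulnC leq_trunc_div.
rewrite -(ltr_pM2l mR); apply: (lt_le_trans h2).
by rewrite -natrM ler_nat mulnC ltn_ceil.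
Qed.

(* Writes t in base 2 and deals out i successive binary digits to each free position i. *)
Definition free_bits (R : realType) (sigma : nat -> nat) (t : R) (i : nat) : nat :=
  Num.trunc ((2 ^ free_weight sigma i.+1)%:R * t).

(** At a free position i the new integer has the previous one as quotient by 2^i, and its remainder
    is read from the digit; at other positions the integer does not change. *)
Lemma free_bits_eq (R : realType) (sigma : nat -> nat) (t u : R) (m : nat) :
  0 <= t < 1 -> 0 <= u < 1 ->
  (forall i, (i < m)%N -> block_digit sigma (free_bits sigma t) i.+1 =
                          block_digit sigma (free_bits sigma u) i.+1) ->
  free_bits sigma t m = free_bits sigma u m.
Proof.
move=> t01 u01; have [/andP[t0 t1] /andP[u0 u1]] := (t01, u01).
elim: m => [|m ih] h.
  (* Position 0 has weight 0, free or not, so no binary digit has been read and both truncations are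
     0. *)
  rewrite /free_bits free_weightS /free_weight big_ord0 add0n if_same expn0 !mul1r.
  by rewrite !(@truncn_def _ _ 0%N) ?t01 ?u01.
have e : free_bits sigma t m = free_bits sigma u m.
  by apply: ih => i im; apply: h; exact: ltnW.
have [f|nf] := boolP (free_pos sigma m.+1); last first.
  by move: e; rewrite /free_bits (free_weightS _ m.+1) (negbTE nf) addn0.
have := h m (ltnSn m); rewrite !block_digit_free // => /addnI em.
have step (v : R) : 0 <= v ->
    (free_bits sigma v m.+1 %/ 2 ^ m.+1)%N = free_bits sigma v m.
  move=> v0; rewrite /free_bits (free_weightS _ m.+1) f expnD mulnC natrM -mulrA.
  by rewrite truncn_mul_div ?mulr_ge0 // expn_gt0.
by rewrite (divn_eq (free_bits sigma t m.+1) (2 ^ m.+1)) step // e -step // em -divn_eq.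
Qed.

Lemma free_bits_dist (R : realType) (sigma : nat -> nat) (t u : R) (m : nat) :
  0 <= t -> 0 <= u -> free_bits sigma t m = free_bits sigma u m ->
  `|t - u| <= 2 `^ (- (free_weight sigma m.+1)%:R).
Proof.
move=> t0 u0; rewrite /free_bits.
rewrite powRN powR_mulrn // natrX; set w : R := 2 ^+ _ => e.
have w0 : 0 < w by rewrite exprn_gt0.
have := truncn_itv (mulr_ge0 (ltW w0) t0); rewrite e.
have := truncn_itv (mulr_ge0 (ltW w0) u0).
rewrite -natr1 => /andP[h1 h2] /andP[h3 h4].
rewrite -(ler_pM2l w0) mulfV ?gt_eqF // -{1}(gtr0_norm w0) -normrM mulrBr.
by rewrite ler_norml; apply/andP; split; lra.
Qed.

(** With B i = 2^(i+1), the exponents 2(i+1) for i = 1, ..., m+1 sum to (m+1)^2 + 3(m+1), and the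
    last factor adds m + 3. *)
Lemma cf_dist_ge_pow2 (R : realType) (m : nat) (x y : R) :
  cfdom x -> cfdom y ->
  (forall i, (pq i.+1 x)%:~R + 1 <= 2 ^+ i.+2 :> R /\ (pq i.+1 y)%:~R + 1 <= 2 ^+ i.+2 :> R) ->
  (forall i, (i < m)%N -> pq i.+1 x = pq i.+1 y) -> pq m.+1 x <> pq m.+1 y ->
  2 `^ (- (m.+1%:R ^+ 2 + 4 * m.+1%:R + 2)) <= `|x - y|.
Proof.
move=> cx cy hB e ne.
have := @cf_dist_ge R m (fun i => 2 ^+ i.+1) x y cx cy hB e ne.
apply: le_trans.
have -> : m.+1%:R ^+ 2 + 4 * m.+1%:R + 2 = (m.+1 ^ 2 + 4 * m.+1 + 2)%N%:R :> R.
  by rewrite !natrD natrX natrM.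
rewrite powRN powR_mulrn //.
have -> : \prod_(i < m.+1) ((2 : R) ^+ i.+2) ^- 2 = 2 ^- (m.+1 ^ 2 + 3 * m.+1).
  elim: (m.+1) => [|k ih]; first by rewrite big_ord0 expr0 invr1.
  rewrite big_ord_recr /= ih -invfM -exprM -exprD; congr (_ ^- _); lia.
by rewrite -invfM -exprD le_eqVlt; apply/orP; left; apply/eqP; congr (_ ^- _); lia.
Qed.

Lemma hausdorff_measure_Gset_neq0 (R : realType) (sigma : nat -> nat) (s theta : R) (N : nat) :
  spread sigma -> 0 < s -> 0 <= theta -> theta < 1 - 2 * s ->
  (forall n, (N <= n)%N -> n%:R <= theta * (sigma n.+1 - sigma n)%:R) ->
  hausdorff_measure s (Gset sigma) != 0%E.
Proof.
move=> hs s0 th0 ths hth.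
have hth' n : (N.+1 <= n)%N -> n%:R <= theta * (sigma n.+1 - sigma n)%:R.
  by move=> h; apply: hth; exact: ltnW.
have [K hK] := free_weight_ge hs (isT : (0 < N.+1)%N) th0 s0 ths hth'.
have [g hg] : {g : R -> R & forall t, cfdom (g t) /\
    forall n, pq n.+1 (g t) = (block_digit sigma (free_bits sigma t) n.+1)%:Z}.
  apply: (@choice _ _ (fun t x => cfdom x /\
    forall n, pq n.+1 x = (block_digit sigma (free_bits sigma t) n.+1)%:Z)) => t.
  apply: (@cf_exists R (fun n => block_digit sigma (free_bits sigma t) n.+1)) => i.
  exact: block_digit_ge2.
have C0 : 0 < 2 `^ K :> R by rewrite powR_gt0.
apply: (@hausdorff_measure_neq0 _ _ (2 `^ K) _ g) => //.
  by move=> t _; have [h1 h2] := hg t; exact: block_digit_Gset h2.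
move=> t u t01 u01; have [/andP[t0 _] /andP[u0 _]] := (t01, u01).
pose D m : R := m.+1%:R ^+ 2 + 4 * m.+1%:R + 2.
have hD m : 2 `^ (- (free_weight sigma m.+1)%:R) <= 2 `^ K * (2 `^ (- D m)) `^ s :> R.
  rewrite -powRrM -powRD; last by apply/implyP.
  by rewrite ler_powR ?ler1n //; have := hK m.+1; rewrite -/(D m); lra.
(* At the first differing digit, the shared binary digits bound |t - u| from above and the continued
   fractions separate the images from below; [hD] compares the two. *)
have [[m hm]|nd] := pselect (exists m, block_digit sigma (free_bits sigma t) m.+1 !=
                                      block_digit sigma (free_bits sigma u) m.+1).
  have ex : exists m, block_digit sigma (free_bits sigma t) m.+1 !=
                      block_digit sigma (free_bits sigma u) m.+1 by exists m.
  case: (ex_minnP ex) => k /eqP hk mink {m hm ex}.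
  have agree i : (i < k)%N -> block_digit sigma (free_bits sigma t) i.+1 =
                              block_digit sigma (free_bits sigma u) i.+1.
    by move=> ik; apply/eqP; apply: contraTT ik => /mink; rewrite -leqNgt.
  apply: (le_trans (free_bits_dist t0 u0 (free_bits_eq t01 u01 agree))).
  apply: (le_trans (hD k)); rewrite ler_pM2l //.
  apply: ge0_ler_powR; rewrite ?nnegrE ?powR_ge0 ?(ltW s0) //.
  have [[ct ht] [cu hu]] := (hg t, hg u).
  apply: cf_dist_ge_pow2 => //.
  - move=> i; rewrite ht hu -!pmulrn !natr1 -natrX !ler_nat.
    by split; exact: block_digit_lt.
  - by move=> i ik; rewrite ht hu agree.
  - by rewrite ht hu => -[].
suff -> : t = u by rewrite subrr normr0 mulr_ge0 ?powR_ge0 // ltW.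
have agree i : block_digit sigma (free_bits sigma t) i.+1 =
               block_digit sigma (free_bits sigma u) i.+1.
  by apply/eqP; apply: contra_notT nd => h; exists i.
apply/eqP; rewrite -subr_eq0 -normr_le0 leNgt; apply/negP => d0.
have [n] := exists_exprN_lt d0; apply/negP; rewrite -leNgt.
(* If no digit differs, all binary digits agree: m is taken with s m > |2n + K|, so that the free
   weight exceeds 2n and |t - u| <= 4^(-n). *)
pose m := Num.bound (`|2 * n%:R + K| / s).
apply: (le_trans (free_bits_dist t0 u0 (free_bits_eq t01 u01 (fun i _ => agree i)))).
have -> : 4 ^- n = 2 `^ (- (2 * n)%:R) :> R.
  by rewrite powRN powR_mulrn // exprM; congr (_ ^- n); ring.
rewrite ler_powR ?ler1n // lerN2 natrM.
have hm : `|2 * n%:R + K| / s < m%:R by apply: archi_boundP; rewrite divr_ge0 // ltW.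
rewrite ltr_pdivrMr // in hm.
have := hK m.+1; have := ler_norm (2 * n%:R + K).
have : (m%:R : R) <= m.+1%:R by rewrite ler_nat.
have : 0 <= (m.+1%:R : R) ^+ 2 by rewrite exprn_ge0.
have : 0 <= (m.+1%:R : R) by [].
nra.
Qed.

(** * Power sums *)

Lemma powRDp (R : realType) (x r t : R) : 0 < x -> x `^ (r + t) = x `^ r * x `^ t.
Proof. by move=> x0; rewrite powRD //; apply/implyP => _; rewrite gt_eqF. Qed.

(** Young's inequality for (1 - u)^r and 1, with conjugate exponents 1/r and 1/(1 - r). *)
Lemma bernoulli_powR (R : realType) (u r : R) : 0 <= u <= 1 -> 0 < r < 1 ->
  (1 - u) `^ r <= 1 - r * u.
Proof.
move=> /andP[u0 u1] /andP[r0 r1].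
have r1' : 0 < 1 - r by lra.
have := @conjugate_powR R ((1 - u) `^ r) 1 r^-1 (1 - r)^-1.
rewrite powR_ge0 ler01 !invr_gt0 r0 r1' !invrK => /(_ isT isT isT isT).
rewrite addrC subrK => /(_ erefl).
rewrite mulr1 -powRrM mulfV ?gt_eqF // powRr1 ?subr_ge0 // powR1; lra.
Qed.

(** Bernoulli's inequality at u = 1/(m+1). It bounds the increments of x^r from below, and the sums
    below telescope by it. *)
Lemma natr_pred_powR (R : realType) (m : nat) (r : R) : 0 < r < 1 ->
  m%:R `^ r <= m.+1%:R `^ r * (1 - r / m.+1%:R).
Proof.
move=> r01.
have m0 : (0 : R) < m.+1%:R by rewrite ltr0n.
have -> : m%:R = m.+1%:R * (1 - m.+1%:R^-1) :> R.
  by rewrite mulrBr mulr1 mulfV ?gt_eqF // -natr1 addrK.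
have m1 : m.+1%:R^-1 <= 1 :> R by rewrite invf_le1 // ler1n.
rewrite powRM ?ler0n ?subr_ge0 //.
rewrite ler_wpM2l ?powR_ge0 // bernoulli_powR // m1 invr_ge0 ltW //.
Qed.

Lemma sum_powR_le (R : realType) (r : R) (m : nat) : 0 < r < 1 ->
  \sum_(b < m) b.+1%:R `^ (r - 1) <= m%:R `^ r / r.
Proof.
move=> r01; have /andP[r0 r1] := r01.
elim: m => [|m ih]; first by rewrite big_ord0 divr_ge0 ?powR_ge0 ?ltW.
rewrite big_ord_recr /=; apply: (@le_trans _ _ (m%:R `^ r / r + m.+1%:R `^ (r - 1))).
  by rewrite lerD2r.
rewrite -(ler_pM2r r0) mulrDl !mulfVK ?gt_eqF //.
have m0 : (0 : R) < m.+1%:R by rewrite ltr0n.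
have -> : m.+1%:R `^ (r - 1) = m.+1%:R `^ r / m.+1%:R :> R.
  by rewrite powRDp // powR_inv1 // ltW.
have := natr_pred_powR m r01.
set x := m%:R `^ r; set y := m.+1%:R `^ r; set u := m.+1%:R^-1; lra.
Qed.

Lemma tail_powR_le (R : realType) (e : R) (p m : nat) : 0 < e < 1 -> (0 < p)%N ->
  \sum_(b < m) (p + b).+1%:R `^ (- (1 + e)) <= p%:R `^ (- e) / e.
Proof.
move=> e01 p0; have /andP[e0 e1] := e01.
suff : \sum_(b < m) (p + b).+1%:R `^ (- (1 + e)) <= (p%:R `^ (- e) - (p + m)%:R `^ (- e)) / e.
  move/le_trans; apply; rewrite ler_pM2r ?invr_gt0 // gerBl powR_ge0 //.
elim: m => [|m ih]; first by rewrite big_ord0 addn0 subrr mul0r.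
rewrite big_ord_recr /=.
apply: (le_trans (lerD ih (lexx _))).
rewrite -(ler_pM2r e0) mulrDl !mulfVK ?gt_eqF // addnS; set n := (p + m)%N.
have n0 : (0 : R) < n%:R by rewrite ltr0n /n; lia.
have n10 : (0 : R) < n.+1%:R by rewrite ltr0n.
have n1 : n.+1%:R^-1 <= 1 :> R by rewrite invf_le1 // ler1n.
have n2 : 0 < n.+1%:R^-1 :> R by rewrite invr_gt0.
have := natr_pred_powR n e01.
have -> : n.+1%:R `^ (- (1 + e)) = n.+1%:R `^ (- e) * n.+1%:R^-1 :> R.
  by rewrite opprD addrC powRDp // powR_inv1 // ltW.
rewrite !powRN.
have : 0 < n%:R `^ e :> R by rewrite powR_gt0.
have : 0 < n.+1%:R `^ e :> R by rewrite powR_gt0.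
set x := n%:R `^ e; set y := n.+1%:R `^ e; set u := n.+1%:R^-1 in n1 n2 * => y0 x0 h.
(* Inverting x <= y (1 - e u) uses (1 - e u)(1 + e u) <= 1. *)
have h2 : y^-1 * (1 + e * u) <= x^-1.
  rewrite mulrC ler_pdivrMr // ler_pdivlMl //.
  have eu : 0 < e * u by rewrite mulr_gt0.
  have eu1 : 0 <= 1 + e * u by lra.
  apply: (le_trans (ler_wpM2r eu1 h)).
  have := mulr_ge0 (ltW y0) (sqr_ge0 (e * u)); lra.
lra.
Qed.

Lemma sum_invsq_le2 (R : realType) (m : nat) : \sum_(i < m) i.+1%:R ^- 2 <= 2 :> R.
Proof.
case: m => [|m]; first by rewrite big_ord0.
suff : \sum_(i < m.+1) i.+1%:R ^- 2 <= 2 - m.+1%:R^-1 :> R.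
  by move/le_trans; apply; rewrite gerBl invr_ge0.
elim: m => [|m ih]; first by rewrite big_ord1 expr1n invr1; lra.
rewrite big_ord_recr /=; apply: (le_trans (lerD ih (lexx _))).
have x0 : (0 : R) < m.+1%:R by rewrite ltr0n.
rewrite -(natr1 m.+1); set x := m.+1%:R in x0 *.
rewrite -subr_ge0.
have -> : 2 - (x + 1)^-1 - (2 - x^-1 + (x + 1) ^- 2) = (x * (x + 1) ^+ 2)^-1.
  by field; rewrite !gt_eqF //; lra.
by rewrite invr_ge0 mulr_ge0 ?exprn_ge0 //; lra.
Qed.

Lemma powR_large (R : realType) (e M : R) : 0 < e -> 0 < M ->
  exists n0 : nat, forall n, (n0 <= n)%N -> M <= n%:R `^ e.
Proof.
move=> e0 M0; exists (Num.bound (M `^ e^-1)) => n hn.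
have h : M `^ e^-1 <= n%:R.
  apply: (le_trans (ltW (archi_boundP (powR_ge0 _ _)))).
  by rewrite ler_nat.
have -> : M = (M `^ e^-1) `^ e by rewrite -powRrM mulVf ?gt_eqF // powRr1 ?ltW.
by apply: ge0_ler_powR; rewrite ?nnegrE ?powR_ge0 ?ler0n ?(ltW e0).
Qed.

(** For l >= 1 the term A + l D dominates the weighted geometric mean A^(1-eta) D^eta; the term l =
    0 is bounded by 1. A small share eta of the decay goes to D, so that sums over D converge
    too. *)
Lemma ap_prod_le (R : realType) (s eta : R) (n A D : nat) :
  0 < s -> 0 <= eta <= 1 -> (0 < A)%N -> (0 < D)%N ->
  \prod_(l < n.+1) (A + l * D)%:R `^ (- (2 * s)) <=
  A%:R `^ (- (2 * s * (1 - eta) * n%:R)) * D%:R `^ (- (2 * s * eta * n%:R)) :> R.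
Proof.
move=> s0 /andP[eta0 eta1] A0 D0.
have A1 : (1 : R) <= A%:R by rewrite ler1n.
have D1 : (1 : R) <= D%:R by rewrite ler1n.
have AR : (0 : R) < A%:R by rewrite ltr0n.
have DR : (0 : R) < D%:R by rewrite ltr0n.
rewrite big_ord_recl mul0n addn0.
apply: (@le_trans _ _ (1 * \prod_(i < n) (A%:R `^ (1 - eta) * D%:R `^ eta) `^ (- (2 * s)))).
  apply: ler_pM; rewrite ?powR_ge0 //.
  - by apply: prodr_ge0 => i _; exact: powR_ge0.
  - apply: (@le_trans _ _ (A%:R `^ 0)); last by rewrite powRr0.
    by rewrite ler_powR //; lra.
  apply: ler_prod => i _; rewrite powR_ge0 /= /bump leq0n.
  rewrite !powRN lef_pV2 ?posrE ?powR_gt0 ?mulr_gt0 ?powR_gt0 ?ltr0n //; last lia.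
  apply: ge0_ler_powR; rewrite ?nnegrE ?mulr_ge0 ?powR_ge0 ?(ltW s0) //.
  set X : R := (A + _)%:R.
  have X0 : 0 < X by rewrite ltr0n; lia.
  have -> : X = X `^ (1 - eta) * X `^ eta.
    by rewrite -powRDp // subrK powRr1 // ltW.
  apply: ler_pM; rewrite ?powR_ge0 //; apply: ge0_ler_powR; rewrite ?nnegrE ?ler0n ?(ltW X0) //.
  - by rewrite subr_ge0.
  - by rewrite ler_nat; lia.
  - by rewrite ler_nat; nia.
rewrite mul1r prodr_const card_ord -powR_mulrn ?powR_ge0 // -powRrM.
rewrite powRM ?powR_ge0 // -!powRrM.
by rewrite le_eqVlt; apply/orP; left; apply/eqP; congr (_ `^ _ * _ `^ _); ring.
Qed.

(* Here k is the number of free digits before a progression of n + 1 digits: the left-hand side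
   is roughly A^((1-2s)k - 2sn), and the exponent tends to -oo since k <= (B - 1)n. *)
Lemma block_factor_le (R : realType) (s B : R) :
  0 < s -> 2 * s < 1 -> 1 <= B -> (1 - 2 * s) * (B - 1) < 2 * s ->
  exists n0 : nat, forall n k A D : nat,
    (n0 <= n)%N -> (n <= A)%N -> (0 < D)%N -> k%:R <= (B - 1) * n%:R ->
    (\sum_(b < A) b.+1%:R `^ (- (2 * s))) ^+ k *
    \prod_(l < n.+1) (A + l * D)%:R `^ (- (2 * s)) <= A%:R ^- 2 * D%:R ^- 2 / 8 :> R.
Proof.
move=> s0 s1 B1 hB.
(* The exponent of A is about -kap n. Losses are at most kap n / 4 through eps, which absorbs the
   constant 1/r of [sum_powR_le], and kap n / 4 through eta. *)
pose r := 1 - 2 * s; pose kap := 2 * s - r * (B - 1).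
have k0 : 0 < kap by rewrite /kap /r; lra.
have k1 : kap <= 1.
  have : 0 <= r * (B - 1) by rewrite mulr_ge0 // /r; lra.
  by rewrite /kap; lra.
pose eps := kap / (4 * B); have e0 : 0 < eps by rewrite divr_gt0 //; lra.
pose eta := kap / 4; have et0 : 0 < eta by rewrite divr_gt0.
have r01 : 0 < r < 1 by rewrite /r; apply/andP; split; lra.
have /andP[r0 r1] := r01.
have [n1 hn1] := @powR_large R eps r^-1 e0 ltac:(rewrite invr_gt0 //).
have [n2 h2] : exists n2 : nat, 6 / kap < n2%:R.
  by eexists; apply: archi_boundP; rewrite divr_ge0 // ltW.
have se0 : 0 < s * eta by rewrite mulr_gt0.
have [n3 h3] : exists n3 : nat, (s * eta)^-1 < n3%:R.
  by eexists; apply: archi_boundP; rewrite invr_ge0 ltW.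
(* Past n1, A^eps >= 1/r; past n2 the exponent of A is at most -3; past n3 that of D is at most -2;
   and A >= 8 turns A^(-3) into A^(-2)/8. *)
exists (n1 + n2 + n3 + 8)%N => n k A D hn nA D0 hk.
have [nn1 nn2 nn3 nn8] : [/\ n1 <= n, n2 <= n, n3 <= n & 8 <= n]%N.
  by clear - hn; split; lia.
have A8n : (8 <= A)%N := leq_trans nn8 nA.
have A0 : (0 < A)%N by apply: leq_trans A8n.
have hn2 : 3 <= kap / 2 * n%:R.
  have h := h2; rewrite ltr_pdivrMr // in h.
  have : (n2%:R : R) <= n%:R by rewrite ler_nat.
  by move=> h'; have := ler_wpM2r (ltW k0) h'; lra.
have hn3 : 1 <= s * eta * n%:R.
  have h : (s * eta)^-1 <= n%:R by apply: (le_trans (ltW h3)); rewrite ler_nat.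
  by have := ler_wpM2l (ltW se0) h; rewrite mulfV ?gt_eqF.
have A1 : (1 : R) <= A%:R by rewrite ler1n.
have D1 : (1 : R) <= D%:R by rewrite ler1n.
have A8 : (8 : R) <= A%:R by rewrite ler_nat.
have AR : (0 : R) < A%:R by lra.
have hS : \sum_(b < A) b.+1%:R `^ (- (2 * s)) <= A%:R `^ (r + eps).
  have -> : - (2 * s) = r - 1 by rewrite /r; ring.
  apply: (le_trans (sum_powR_le A r01)).
  rewrite (powRDp r eps AR).
  by rewrite ler_wpM2l ?powR_ge0 // hn1 // (leq_trans nn1 nA).
have S0 : 0 <= \sum_(b < A) b.+1%:R `^ (- (2 * s)) :> R.
  by apply: sumr_ge0 => b _; exact: powR_ge0.
have hSk : (\sum_(b < A) b.+1%:R `^ (- (2 * s))) ^+ k <= A%:R `^ ((r + eps) * ((B - 1) * n%:R)).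
  apply: (@le_trans _ _ ((A%:R `^ (r + eps)) ^+ k)); first by rewrite lerXn2r ?nnegrE ?powR_ge0.
  rewrite -powR_mulrn ?powR_ge0 // -powRrM ler_powR //.
  by rewrite ler_wpM2l //; lra.
have et01 : 0 <= eta <= 1 by rewrite /eta; apply/andP; split; lra.
have hQ := ap_prod_le n s0 et01 A0 D0.
apply: (@le_trans _ _ (A%:R `^ ((r + eps) * ((B - 1) * n%:R)) *
   (A%:R `^ (- (2 * s * (1 - eta) * n%:R)) * D%:R `^ (- (2 * s * eta * n%:R))))).
  apply: ler_pM => //; first by rewrite exprn_ge0.
  by apply: prodr_ge0 => l _; exact: powR_ge0.
rewrite mulrA -powRDp //.
rewrite [leRHS]mulrAC; apply: ler_pM; rewrite ?powR_ge0 //.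
  apply: (@le_trans _ _ (A%:R `^ (- 3%:R))).
    rewrite ler_powR //.
    have heps : eps * (B - 1) <= kap / 4.
      rewrite /eps -mulrA ler_pM2l // mulrC ler_pdivrMr; last lra.
      lra.
    have heta : 2 * s * eta <= kap / 4.
      by rewrite -/eta ler_piMl // ltW.
    have n0 : (0 : R) <= n%:R by [].
    have : ((r + eps) * (B - 1) - 2 * s * (1 - eta)) * n%:R <= - (kap / 2) * n%:R.
      rewrite ler_wpM2r //.
      have ek : kap = 2 * s - r * (B - 1) by [].
      clearbody kap eps eta r; lra.
    lra.
  rewrite powRN powR_mulrn ?ler0n // exprSr invfM.
  by rewrite ler_wpM2l ?invr_ge0 ?exprn_ge0 // lef_pV2 ?posrE.
rewrite powRN lef_pV2 ?posrE ?powR_gt0 ?exprn_gt0 ?ltr0n // -powR_mulrn ?ler0n //.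
rewrite ler_powR //; lra.
Qed.

(** * Covers by cylinders *)

Lemma Jset_cfdom (R : realType) (x : R) : Jset x -> cfdom x.
Proof. by move=> [x01 [ix _]]. Qed.

Lemma Jset_pq_ge (R : realType) (x : R) (n : nat) : Jset x -> (1 <= n)%N -> n%:Z <= pq n x.
Proof.
move=> Jx; elim: n => // -[_ _|n ih _].
  by have := pq1_gt0 (Jset_cfdom Jx).
have [_ [_ h]] := Jx; have := ih isT; have := h n.+1 isT; lia.
Qed.

Lemma Jset_pq_lt (R : realType) (x : R) (m n : nat) : Jset x -> (1 <= m)%N -> (m < n)%N ->
  pq m x < pq n x.
Proof.
move=> [_ [_ h]] m1; elim: n => // n ih; rewrite ltnS leq_eqVlt => /orP[/eqP <-|mn].
  exact: h.
by apply: (lt_trans (ih mn)); apply: h; lia.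
Qed.

(* Digits are indexed from 1: a cylinder of level p prescribes the digits 1, ..., p - 1. *)
Definition cyl (R : realType) (E : set R) (w : nat -> nat) (p : nat) : set R :=
  [set x | E x /\ forall i, (1 <= i < p)%N -> pq i x = (w i)%:Z].

(** The s-th power of the diameter bound that [cf_dist_le] gives for the cylinder. *)
Definition cyl_weight (R : realType) (s : R) (w : nat -> nat) (p : nat) : R :=
  \prod_(1 <= i < p) (w i)%:R `^ (- (2 * s)).

Lemma cyl_weight_ge0 (R : realType) (s : R) (w : nat -> nat) (p : nat) :
  0 <= cyl_weight s w p.
Proof. by apply: prodr_ge0 => i _; exact: powR_ge0. Qed.

Lemma cyl_weightE (R : realType) (s : R) (w : nat -> nat) (p : nat) :
  cyl_weight s w p = (\prod_(i < p.-1) ((w i.+1)%:R : R) ^- 2) `^ s.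
Proof.
rewrite /cyl_weight; case: p => [|p] /=.
  by rewrite big_geq // big_ord0 powR1.
rewrite big_add1 /= big_mkord.
elim: p => [|p ih]; first by rewrite !big_ord0 powR1.
have w0 i : 0 <= ((w i)%:R : R) ^- 2 by rewrite invr_ge0 exprn_ge0.
have P0 : 0 <= \prod_(i < p) ((w i.+1)%:R : R) ^- 2 by apply: prodr_ge0.
rewrite !big_ord_recr /= ih powRM //.
congr (_ * _); rewrite -powR_invn ?ler0n // -powRrM; congr (_ `^ _); ring.
Qed.

(** Digits of points of J satisfy w i >= i, so digit m alone forces diameter at most m^(-2) <= 1/m
    <= d. *)
Lemma has_cover_cyl (R : realType) (s d : R) (E : set R) (w : nat -> nat) (p m : nat) :
  0 < s -> 0 < d -> E `<=` @Jset R -> (0 < m < p)%N -> m%:R^-1 <= d ->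
  has_cover s d (cyl E w p) (cyl_weight s w p).
Proof.
move=> s0 d0 EJ /andP[m0 mp] md.
have [->|/set0P[x0 [Ex0 hx0]]] := eqVneq (cyl E w p) set0.
  by apply: has_cover_set0 => //; exact: cyl_weight_ge0.
have wi i : (1 <= i < p)%N -> (i <= w i)%N.
  move=> ip; rewrite -lez_nat -hx0 //; apply: Jset_pq_ge; first exact: EJ.
  by case/andP: ip.
rewrite cyl_weightE; apply: has_cover_set => //.
- by apply: prodr_ge0 => i _; rewrite invr_ge0 exprn_ge0.
- apply: le_trans md.
  have hm : (m.-1 < p.-1)%N by lia.
  rewrite (bigD1 (Ordinal hm)) //= prednK //.
  apply: (@le_trans _ _ (m%:R ^- 2 * 1)).
    apply: ler_pM; rewrite ?invr_ge0 ?exprn_ge0 //.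
    + by apply: prodr_ge0 => i _; rewrite invr_ge0 exprn_ge0.
    + have wm : (m <= w m)%N by apply: wi; lia.
      rewrite lef_pV2 ?posrE ?exprn_gt0 ?ltr0n //; last by lia.
      by rewrite lerXn2r ?nnegrE // ler_nat.
    + apply: prodr_ile1 => i _; rewrite invr_ge0 exprn_ge0 //=.
      have hi := ltn_ord i; have wm : (i.+1 <= w i.+1)%N by apply: wi; lia.
      have w1 : (1 : R) <= (w i.+1)%:R by rewrite ler1n; lia.
      by rewrite invf_le1 ?exprn_gt0 ?exprn_ege1 //; lra.
  rewrite mulr1 lef_pV2 ?posrE ?exprn_gt0 ?ltr0n // ler_eXnr // ler1n //.
move=> x y [Ex hx] [Ey hy].
apply: (@cf_dist_le R p.-1 (fun i => (w i)%:R)); [exact/Jset_cfdom/EJ|exact/Jset_cfdom/EJ|].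
move=> i ip; have ip' : (1 <= i.+1 < p)%N by lia.
have := wi _ ip'; rewrite hx // hy // -pmulrn lexx ltr0n andbT => h; split => //.
by lia.
Qed.

(* Countably many initial words suffice. *)
Lemma has_cover_null_cyl (R : realType) (s d : R) (E : set R) (p : nat) :
  E `<=` @Jset R ->
  (forall w e, 0 < e -> has_cover s d (cyl E w p) e) ->
  forall e, 0 < e -> has_cover s d E e.
Proof.
move=> EJ h e e0.
pose W n : nat -> nat := nth 0%N (odflt [::] (@unpickle (seq nat) n)).
apply: (@has_coverS _ _ _ _ (\bigcup_n cyl E (W n) p) e) => //; last first.
  by apply: has_cover_null_bigcup => // n; exact: h.
move=> x Ex.
exists (pickle [seq `|pq i x|%N | i <- iota 0 p]) => //; split => // i /andP[i1 ip].
rewrite /W pickleK /= (nth_map 0%N) ?size_iota // nth_iota // add0n gez0_abs //.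
by apply: le_trans (Jset_pq_ge (EJ _ Ex) i1).
Qed.

Definition set_digit (w : nat -> nat) (p b : nat) : nat -> nat :=
  fun i => if i == p then b else w i.

Lemma cyl_weight_set_digit (R : realType) (s : R) (w : nat -> nat) (p b : nat) :
  (1 <= p)%N ->
  cyl_weight s (set_digit w p b) p.+1 = cyl_weight s w p * b%:R `^ (- (2 * s)).
Proof.
move=> p1; rewrite /cyl_weight big_nat_recr //= /set_digit eqxx; congr (_ * _).
by apply: eq_big_nat => i /andP[_ ip]; rewrite (ltn_eqF ip).
Qed.

Lemma cyl_set_digit (R : realType) (E : set R) (w : nat -> nat) (p b : nat) (x : R) :
  cyl E w p x -> pq p x = b%:Z -> cyl E (set_digit w p b) p.+1 x.
Proof.
move=> [Ex hx] hb; split => // i /andP[i1 ip]; rewrite /set_digit.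
have [->//|ne] := eqVneq i p.
by apply: hx; rewrite i1 /= ltn_neqAle ne -ltnS.
Qed.

Lemma exists_half_lt (R : realType) (c e : R) : 0 <= c -> 0 < e ->
  exists k0, forall k, (k0 <= k)%N -> c * 2 ^- k <= e.
Proof.
move=> c0 e0; exists (Num.bound (c / e)) => k hk.
have k2 : (0 : R) < 2 ^+ k by rewrite exprn_gt0.
rewrite ler_pdivrMr // mulrC -ler_pdivrMr //.
apply: (@le_trans _ _ (Num.bound (c / e))%:R).
  by apply/ltW/archi_boundP; rewrite divr_ge0 // ltW.
by rewrite -natrX ler_nat; apply: (leq_trans hk); rewrite ltnW // ltn_expl.
Qed.

Lemma exists_inv_le (R : realType) (d : R) : 0 < d ->
  exists m : nat, (0 < m)%N /\ forall k, (m <= k)%N -> k%:R^-1 <= d.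
Proof.
move=> d0; exists (Num.bound d^-1).+1; split => // k hk.
rewrite -[leRHS]invrK lef_pV2 ?posrE ?invr_gt0 // ?ltr0n; last by apply: leq_trans hk.
apply: (@le_trans _ _ (Num.bound d^-1)%:R).
  by apply/ltW/archi_boundP; rewrite invr_ge0 ltW.
by rewrite ler_nat ltnW.
Qed.

(** For 2s > 1 the series of b^(-2s) converges, and digit p is at least p in J. Far enough out, each
    further digit therefore halves the cost of covering a cylinder. *)
Lemma hausdorff_measure_Jset (R : realType) (s : R) : 1 < 2 * s < 2 ->
  hausdorff_measure s (@Jset R) = 0%E.
Proof.
move=> /andP[s1 s2]; have s0 : 0 < s by lra.
pose e := 2 * s - 1; have e01 : 0 < e < 1 by rewrite /e; apply/andP; split; lra.
have /andP[e0 _] := e01.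
have [p1 hp1] := @powR_large R e (2 / e) e0 ltac:(rewrite divr_gt0 //).
apply: hausdorff_measure_eq0 => d eps d0 eps0.
have [m [m0 hm]] := exists_inv_le d0.
have tail p n : (p1.+2 <= p)%N -> \sum_(b < n) (p + b)%:R `^ (- (2 * s)) <= 2^-1 :> R.
  case: p => // p hp.
  have [p0 pp] : (0 < p)%N /\ (p1 <= p)%N by clear - hp; lia.
  have := tail_powR_le n e01 p0.
  have -> : 1 + e = 2 * s by rewrite /e; ring.
  move/le_trans; apply.
  have hP := hp1 p pp.
  have pe : 0 < p%:R `^ e :> R by rewrite powR_gt0 // ltr0n.
  rewrite powRN -invfM lef_pV2 ?posrE //; last by rewrite mulr_gt0.
  by rewrite -ler_pdivrMr.
have main k p w : (p1.+2 <= p)%N -> (m < p + k)%N ->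
    has_cover s d (cyl (@Jset R) w p) (cyl_weight s w p * 2 ^- k).
  elim: k p w => [|k ih] p w hp hk.
    rewrite expr0 invr1 mulr1; apply: (@has_cover_cyl _ _ _ _ _ _ m) => //.
      by rewrite m0; rewrite addn0 in hk.
    exact: hm.
  have p0 : (0 < p)%N by apply: leq_trans hp.
  pose F b := cyl (@Jset R) (set_digit w p (p + b)) p.+1.
  apply: (@has_coverS _ _ _ _ (\bigcup_b F b) (cyl_weight s w p * 2 ^- k.+1)) => //.
    move=> x [Jx hx]; have := Jset_pq_ge Jx p0.
    case e' : (pq p x) => [q|//] pq'; exists (q - p)%N => //.
    by apply: cyl_set_digit => //; rewrite e' subnKC // -lez_nat.
  apply: (@has_cover_bigcup _ _ _ _
      (fun b => cyl_weight s (set_digit w p (p + b)) p.+1 * 2 ^- k)) => [b|n].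
    by apply: ih; [exact: leqW|rewrite addSnnS].
  have -> : \sum_(i < n) cyl_weight s (set_digit w p (p + i)) p.+1 * 2 ^- k =
      cyl_weight s w p * 2 ^- k * \sum_(i < n) (p + i)%:R `^ (- (2 * s)) :> R.
    rewrite mulr_sumr; apply: eq_bigr => i _; rewrite cyl_weight_set_digit //; ring.
  rewrite exprSr invfM mulrA ler_wpM2l ?tail //.
  by rewrite mulr_ge0 ?cyl_weight_ge0 // invr_ge0 exprn_ge0.
apply: (@has_cover_null_cyl _ _ _ _ p1.+2) => // w e' e'0.
have [k0 hk0] := exists_half_lt (cyl_weight_ge0 s w p1.+2) e'0.
apply: (@has_coverS _ _ _ _ (cyl (@Jset R) w p1.+2) (cyl_weight s w p1.+2 * 2 ^- (k0 + m))) => //.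
  by apply: hk0; exact: leq_addr.
by apply: main => //; clear; lia.
Qed.

(** * Blocks and the dimension formula *)

Lemma is_AP_pq (R : realType) (x : R) (m n l A D : nat) :
  is_AP m n x -> pq m x = A%:Z -> pq m.+1 x = (A + D)%N%:Z -> (l < n)%N ->
  pq (m + l) x = (A + l * D)%N%:Z.
Proof.
move=> ap hA hD; elim: l => [|l ih] ln; first by rewrite addn0 mul0n addn0.
have := ap l ln; have := ih (ltnW ln); rewrite hA hD addnS; lia.
Qed.

(* The digits q, ..., m - 1 before the progression are all smaller than its first term A, so
   each of them contributes a factor sum_(b <= A) b^(-2s). *)
Lemma has_cover_free_digits (R : realType) (s d c : R) (E : set R) (m n A D : nat) :
  0 < s -> 0 < d -> E `<=` @Jset R -> (forall x, E x -> is_AP m n x) -> (0 < m)%N ->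
  (forall w, has_cover s d (cyl E w (m + n)) (cyl_weight s w (m + n) * c)) ->
  forall j q w, (1 <= q)%N -> (q + j = m)%N ->
  has_cover s d [set x | cyl E w q x /\ pq m x = A%:Z /\ pq m.+1 x = (A + D)%N%:Z]
    (cyl_weight s w q * ((\sum_(b < A) b.+1%:R `^ (- (2 * s))) ^+ j *
       (\prod_(l < n) (A + l * D)%:R `^ (- (2 * s))) * c)).
Proof.
move=> s0 d0 EJ Eap m0 hE; elim=> [|j ih] q w q1 qj.
  have {qj} -> : q = m by rewrite -qj addn0.
  (* No free digit is left: A and D determine the whole progression, so the set lies in one cylinder
     of level m + n. *)
  pose w' i := if (i < m)%N then w i else (A + (i - m) * D)%N.
  have e : cyl_weight s w' (m + n) =
      cyl_weight s w m * \prod_(l < n) (A + l * D)%:R `^ (- (2 * s)).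
    rewrite /cyl_weight (@big_cat_nat _ _ _ m) //= ?leq_addr //; congr (_ * _).
      by apply: eq_big_nat => i /andP[_ im]; rewrite /w' im.
    rewrite -{1}(add0n m) big_addn addKn big_mkord; apply: eq_bigr => i _.
    by rewrite /w' ltnNge leq_addl addnK.
  apply: (has_coverS _ _ (hE w')); last by rewrite e expr0 mul1r mulrA.
  move=> x [[Ex hx] [hA hD]]; split => // i /andP[i1 im]; rewrite /w'.
  case: ltnP => mi; first by apply: hx; rewrite i1.
  by rewrite -(is_AP_pq (Eap _ Ex) hA hD) ?subnKC //; lia.
pose F b := [set x | cyl E (set_digit w q b.+1) q.+1 x /\
                     pq m x = A%:Z /\ pq m.+1 x = (A + D)%N%:Z].
apply: (@has_coverS _ _ _ _ (\bigcup_(b in `I_A) F b) _ _ _ (lexx _)).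
  move=> x [cx [hA hD]]; have Jx := EJ _ cx.1.
  have qm : (q < m)%N by lia.
  have := Jset_pq_lt Jx q1 qm; have := Jset_pq_ge Jx q1; rewrite hA.
  case eb : (pq q x) => [[|b]|//] h1 h2; first by lia.
  by exists b => /=; [lia|split => //; exact: cyl_set_digit].
apply: has_coverS (@has_cover_bigcup_fin _ _ _ A F (fun b => cyl_weight s (set_digit w q b.+1) q.+1 * _) s0 d0 _) => //; last first.
  by move=> b _; apply: ih => //; lia.
under eq_bigr do rewrite cyl_weight_set_digit // -!mulrA.
rewrite -mulr_sumr ler_wpM2l ?cyl_weight_ge0 // -mulr_suml exprS -!mulrA //.
Qed.

(** In J the digit at m is at least m and the difference is positive. The sums of A^(-2) and of
    D^(-2) are at most 2 each, so the factor 1/8 leaves 1/2. *)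
Lemma has_cover_group (R : realType) (s d c : R) (E : set R) (m n q k : nat) (w : nat -> nat) :
  0 < s -> 0 < d -> 0 <= c -> E `<=` @Jset R -> (forall x, E x -> is_AP m n x) -> (0 < m)%N ->
  (forall w, has_cover s d (cyl E w (m + n)) (cyl_weight s w (m + n) * c)) ->
  (1 <= q)%N -> (q + k = m)%N ->
  (forall A D, (m <= A)%N -> (0 < D)%N ->
    (\sum_(b < A) b.+1%:R `^ (- (2 * s))) ^+ k *
    \prod_(l < n) (A + l * D)%:R `^ (- (2 * s)) <= A%:R ^- 2 * D%:R ^- 2 / 8 :> R) ->
  has_cover s d (cyl E w q) (cyl_weight s w q * (c / 2)).
Proof.
move=> s0 d0 c0 EJ Eap m0 hE q1 qk hF.
have cw0 := cyl_weight_ge0 s w q.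
pose F A := [set x | cyl E w q x /\ pq m x = A%:Z].
have hA A : (m <= A)%N -> has_cover s d (F A) (cyl_weight s w q * c / 4 * A%:R ^- 2).
  move=> mA.
  pose H D := [set x | cyl E w q x /\ pq m x = A%:Z /\ pq m.+1 x = (A + D.+1)%N%:Z].
  apply: (@has_coverS _ _ _ _ (\bigcup_D H D) _ _ _ (lexx _)).
    move=> x [cx hx]; have [_ [_ J]] := EJ _ cx.1.
    have := J m m0; rewrite hx; case e : (pq m.+1 x) => [p|//]; rewrite ltz_nat => Ap.
    by exists (p - A.+1)%N => //; split => //; split => //; rewrite e addnS -addSn subnKC.
  apply: (@has_cover_bigcup _ _ _ _ (fun D => cyl_weight s w q * c / 8 * A%:R ^- 2 * D.+1%:R ^- 2)).
    move=> D; apply: (has_coverS _ _ (@has_cover_free_digits R s d c E m n A D.+1 s0 d0 EJ Eap m0 hE k q w q1 qk)) => //.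
    have := hF A D.+1 mA isT => /(ler_wpM2r c0) /(ler_wpM2l cw0) /le_trans; apply.
    by rewrite le_eqVlt; apply/orP; left; apply/eqP; ring.
  move=> M; rewrite -mulr_sumr.
  have := sum_invsq_le2 R M; set S := \sum_(i < M) _ => hS.
  have X0 : 0 <= cyl_weight s w q * c * A%:R ^- 2.
    by rewrite !mulr_ge0 // invr_ge0 exprn_ge0.
  have := ler_wpM2l X0 hS; set X := A%:R ^- 2; lra.
apply: (@has_coverS _ _ _ _ (\bigcup_a F (m + a)%N) _ _ _ (lexx _)).
  move=> x cx; have := Jset_pq_ge (EJ _ cx.1) m0.
  case e : (pq m x) => [p|//]; rewrite lez_nat => mp.
  by exists (p - m)%N => //; split => //; rewrite e subnKC.
apply: (@has_cover_bigcup _ _ _ _ (fun a => cyl_weight s w q * c / 4 * (m + a)%:R ^- 2)).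
  by move=> a; apply: hA; exact: leq_addr.
move=> M; rewrite -mulr_sumr.
have hS : \sum_(i < M) (m + i)%:R ^- 2 <= 2 :> R.
  apply: le_trans (sum_invsq_le2 R M); apply: ler_sum => i _.
  have mi : (i.+1 <= m + i)%N by lia.
  rewrite lef_pV2 ?posrE ?exprn_gt0 ?ltr0n //; last by lia.
  by rewrite lerXn2r ?nnegrE // ler_nat.
have X0 : 0 <= cyl_weight s w q * c by rewrite mulr_ge0.
have := ler_wpM2l X0 hS; lra.
Qed.

(** Each group of digits gains a factor 1/2 by [has_cover_group], so refining through enough groups
    makes the cost arbitrarily small. *)
Lemma hausdorff_measure_Gset_eq0 (R : realType) (sigma : nat -> nat) (s B : R) (N0 : nat) :
  spread sigma -> 0 < s -> 2 * s < 1 -> 1 <= B -> (1 - 2 * s) * (B - 1) < 2 * s ->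
  (forall n, (N0 <= n)%N -> (sigma n.+1 - sigma n)%:R <= B * n%:R :> R) ->
  hausdorff_measure s (Gset sigma) = 0%E.
Proof.
move=> hs s0 s1 B1 hB hsig.
have [n0 hn0] := block_factor_le s0 s1 B1 hB.
apply: hausdorff_measure_eq0 => d eps d0 eps0.
(* Fixing the index from which the blocks are progressions makes the condition uniform; countably
   many such sets exhaust G. *)
pose E N := [set x : R | Jset x /\ forall n, (N <= n)%N -> is_AP (sigma n) n x].
apply: (@has_coverS _ _ _ _ (\bigcup_N E N) _ _ _ (lexx _)).
  by move=> x [Jx [N hN]]; exists N.
apply: has_cover_null_bigcup => // N {}eps {}eps0.
have EJ : E N `<=` @Jset R by move=> x [].
pose n1 := (n0 + N0 + N + 1)%N.
have [m [m0 hm]] := exists_inv_le d0.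
have main k n w : (n1 <= n)%N -> (m <= n + k)%N ->
    has_cover s d (cyl (E N) w (sigma n + n)) (cyl_weight s w (sigma n + n) * 2 ^- k).
  elim: k n w => [|k ih] n w hn hk.
    rewrite expr0 invr1 mulr1; apply: (@has_cover_cyl _ _ _ _ _ _ m) => //; last exact: hm.
    have [] := hs n ltac:(rewrite /n1 in hn; clear - hn; lia).
    by rewrite addn0 in hk; clear - m0 hk; lia.
  have [n1' nn0 nN0 nN] : [/\ 1 <= n, n0 <= n, N0 <= n & N <= n]%N.
    by rewrite /n1 in hn; clear - hn; split; lia.
  have [sn0 sn1] := hs n n1'.
  have [sn' _] := hs n.+1 isT.
  have [nsn _] := spread_ge hs (isT : (0 < n.+1)%N).
  rewrite exprSr invfM; apply: (@has_cover_group R s d _ _ (sigma n.+1) n.+1 _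
     (sigma n.+1 - (sigma n + n))%N) => //.
  - by move=> x [_ h]; apply: h; exact: leqW.
  - by move=> w'; apply: ih; [exact: leqW|rewrite addSnnS].
  - by apply: leq_trans sn0 (leq_addr _ _).
  - by rewrite subnKC.
  move=> A D mA D0; apply: hn0 => //.
    by apply: leq_trans mA; exact: ltnW.
  rewrite subnDA natrB; last by clear - sn1; lia.
  by have := hsig n nN0; lra.
apply: (@has_cover_null_cyl _ _ _ _ (sigma n1 + n1)) => // w e e0.
have [k0 hk0] := exists_half_lt (cyl_weight_ge0 s w (sigma n1 + n1)) e0.
have hk : (m <= n1 + (k0 + m))%N by rewrite addnA leq_addl.
apply: has_coverS (main _ _ w (leqnn _) hk) => //.
by apply: hk0; exact: leq_addr.
Qed.

(** * From Hausdorff measures to the dimension *)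

Lemma hausdorff_measureS (R : realType) (s : R) (E F : set R) :
  E `<=` F -> hausdorff_measure s F = 0%E -> hausdorff_measure s E = 0%E.
Proof.
move=> EF F0; apply/eqP; rewrite eq_le; apply/andP; split.
  rewrite -F0; apply: ge_ereal_sup => _ [d d0 <-].
  apply: le_trans (ereal_sup_ubound _); last by exists d.
  apply: le_ereal_inf_tmp => _ [U [FU dU] <-].
  by apply: ereal_inf_lbound; exists U => //; split => //; exact: subset_trans FU.
apply: (@le_trans _ _ (hausdorff_content s 1 E)); last first.
  by apply: ereal_sup_ubound; exists 1 => /=.
apply: le_ereal_inf_tmp => _ [U _ <-].
by apply: nneseries_ge0 => i _ _; rewrite lee_fin powR_ge0.
Qed.

(** The infimum only needs exponents just above a; the cutoff b allows for upper bounds proved on a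
    bounded range of s. *)
Lemma hausdorff_dim_eq (R : realType) (E : set R) (a b : R) : 0 <= a -> a < b ->
  (forall s, a < s < b -> hausdorff_measure s E = 0%E) ->
  (forall s, 0 < s < a -> hausdorff_measure s E != 0%E) ->
  hausdorff_dim E = a%:E.
Proof.
move=> a0 ab up lo; apply/eqP; rewrite eq_le; apply/andP; split; last first.
  apply: le_ereal_inf_tmp => _ [s [s0 hs] <-]; rewrite lee_fin leNgt; apply/negP => sa.
  by have := lo s; rewrite s0 sa hs eqxx => /(_ isT).
apply/lee_addgt0Pr => e e0.
pose s := Num.min (a + e) ((a + b) / 2).
have sa : a < s by rewrite lt_min; apply/andP; split; lra.
have sb : s < b by rewrite gt_min; apply/orP; right; lra.
have se : s <= a + e by rewrite ge_min lexx.
apply: (@le_trans _ _ s%:E); last by rewrite -EFinD lee_fin.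
apply: ereal_inf_lbound; exists s => //; split; first exact: le_lt_trans sa.
by apply: up; rewrite sa.
Qed.

Lemma cvge_gt_eventually (R : realType) (u : nat -> \bar R) (l : \bar R) (c : R) :
  u @ \oo --> l -> (c%:E < l)%E -> exists N, forall n, (N <= n)%N -> (c%:E < u n)%E.
Proof.
move=> ul cl.
have : nbhs l [set y | (c%:E < y)%E].
  by apply: open_nbhs_nbhs; split => //; exact: open_ereal_gt_ereal.
by move=> /ul [N _ hN]; exists N => n Nn; exact: hN.
Qed.

Lemma cvge_lt_eventually (R : realType) (u : nat -> \bar R) (l : \bar R) (c : R) :
  u @ \oo --> l -> (l < c%:E)%E -> exists N, forall n, (N <= n)%N -> (u n < c%:E)%E.
Proof.
move=> ul cl.
have : nbhs l [set y | (y < c%:E)%E].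
  by apply: open_nbhs_nbhs; split => //; exact: open_ereal_lt_ereal.
by move=> /ul [N _ hN]; exists N => n Nn; exact: hN.
Qed.

(** Any theta above 1/beta eventually bounds the share n / (sigma (n+1) - sigma n) of positions
    taken by blocks. *)
Lemma hausdorff_measure_Gset_neq0_lim (R : realType) (sigma : nat -> nat) (beta : \bar R)
    (s theta : R) :
  spread sigma ->
  ((fun n : nat => ((sigma n.+1 - sigma n)%:R / n%:R : R)%:E) @ \oo --> beta) ->
  0 < s -> 0 < theta -> theta < 1 - 2 * s -> (theta^-1%:E < beta)%E ->
  hausdorff_measure s (Gset sigma) != 0%E.
Proof.
move=> hs hb s0 th0 ths hth.
have [N hN] := cvge_gt_eventually hb hth.
apply: (@hausdorff_measure_Gset_neq0 R sigma s theta N.+1) => //; first exact: ltW.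
move=> n Nn; have n0 : (0 : R) < n%:R by rewrite ltr0n; apply: leq_trans Nn.
have := hN n (ltnW Nn); rewrite lte_fin ltr_pdivlMr // ltr_pdivrMl // => /ltW.
exact.
Qed.

Theorem theorem1p2 (R : realType) (sigma : nat -> nat) (beta : \bar R) :
  (forall n, (1 <= n)%N -> (0 < sigma n)%N) ->
  (forall n, (1 <= n)%N -> (sigma n < sigma n.+1)%N) ->
  (forall n, (1 <= n)%N -> (n <= sigma n.+1 - sigma n)%N) ->
  ((fun n : nat => ((sigma n.+1 - sigma n)%:R / n%:R : R)%:E) @ \oo --> beta) ->
  (1%:E <= beta)%E ->
  hausdorff_dim (Gset sigma) =
    (if beta is r%:E then ((r - 1) / (2 * r))%:E else (1 / 2 : R)%:E).
Proof.
move=> h1 h2 h3 hb b1.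
have hs : spread sigma.
  by move=> n n1; split; [exact: h1|have := h2 n n1; have := h3 n n1; lia].
case: beta hb b1 => [r| |] hb b1 //; last first.
  apply: (@hausdorff_dim_eq R _ _ 1); [lra|lra| |].
    move=> s /andP[sa sb]; apply: (@hausdorff_measureS _ _ _ (@Jset R)).
      by move=> x [].
    by apply: hausdorff_measure_Jset; apply/andP; split; lra.
  move=> s /andP[sa sb].
  apply: (hausdorff_measure_Gset_neq0_lim (theta := (1 - 2 * s) / 2) hs hb) => //; [lra|lra|].
  by rewrite ltry.
have r1 : 1 <= r by rewrite -lee_fin.
have r0 : 0 < r by lra.
have rV : 0 < r^-1 by rewrite invr_gt0.
have ea : (r - 1) / (2 * r) = (1 - r^-1) / 2 by field; rewrite gt_eqF.
have rV1 : r^-1 <= 1 by rewrite invf_le1.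
rewrite ea; apply: (@hausdorff_dim_eq R _ _ 2^-1); [lra|lra| |].
  move=> s /andP[sa sb].
  have s0 : 0 < s by lra.
  have t0 : 0 < 1 - 2 * s by lra.
  (* This restates s > (r - 1)/(2r); B is then the midpoint, an eventual bound for the ratios that
     still satisfies (1 - 2s) B < 1. *)
  have rt : r < (1 - 2 * s)^-1.
    by rewrite -[ltLHS]invrK ltf_pV2 ?posrE //; lra.
  pose B := (r + (1 - 2 * s)^-1) / 2.
  have rB : r < B by rewrite /B; lra.
  have Bt : (1 - 2 * s) * B < 1.
    have : B < (1 - 2 * s)^-1 by rewrite /B; lra.
    by rewrite -(ltr_pM2l t0) mulfV ?gt_eqF.
  have [N hN] := @cvge_lt_eventually _ _ _ B hb ltac:(by rewrite lte_fin).
  apply: (@hausdorff_measure_Gset_eq0 R sigma s B N.+1) => //; [lra|lra|lra|].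
  move=> n Nn; have n0 : (0 : R) < n%:R by rewrite ltr0n; apply: leq_trans Nn.
  by have := hN n (ltnW Nn); rewrite lte_fin ltr_pdivrMr // => /ltW.
move=> s /andP[sa sb].
(* The midpoint of 1/r and 1 - 2s, which are in this order because s < (r - 1)/(2r). *)
pose theta := (r^-1 + (1 - 2 * s)) / 2.
have th0 : 0 < theta by rewrite /theta; lra.
apply: (hausdorff_measure_Gset_neq0_lim (theta := theta) hs hb) => //.
  by rewrite /theta; lra.
rewrite lte_fin -[ltRHS]invrK ltf_pV2 ?posrE // /theta; lra.
Qed.
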